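(* For a symmetric positive definite matrix $\mathcal C\in\mathbb R^{d\times d}$ let $$\rho(\mathcal C)\ =\ \frac12\inf_{|\zeta|=1}\mathbb E_{v\sim\mathrm{Unif}(\mathbb S^{d-1})}\Bigl(\zeta\cdot\frac{\mathcal C^{-1/2}v}{|\mathcal C^{-1/2}v|}\Bigr)^2$$ (infimum over unit vectors $\zeta\in\mathbb R^d$), the Wasserstein contraction rate of Hit-and-Run for the target measure $\mathcal N(0,\mathcal C)$. Then, as functions of $\kappa$: (i) for $d=2$ and $\mathcal C=\operatorname{diag}(\kappa,1)$: $\rho(\mathcal C)\asymp\kappa^{-1/2}$; (ii) for $d=3$ and $\mathcal C=\operatorname{diag}(\kappa,\kappa,1)$: $\rho(\mathcal C)\asymp\kappa^{-1/2}$; (iii) for $d=3$ and $\mathcal C=\operatorname{diag}(\kappa,1,1)$: $\rho(\mathcal C)\asymp\kappa^{-1}\log\kappa$; (iv) for $d=4$ and $\mathcal C=\operatorname{diag}(\kappa,1,1,1)$: $\rho(\mathcal C)\asymp\kappa^{-1}$.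
   Context: For functions $f,g$ of $\kappa$, $f(\kappa)\asymp g(\kappa)$ means that there are constants $k,c,C>0$ such that $c\,g(\kappa')\leq f(\kappa')\leq C\,g(\kappa')$ for all $\kappa'\geq k$. $\mathrm{Unif}(\mathbb S^{d-1})$ is the uniform probability measure on the Euclidean unit sphere in $\mathbb R^d$, and $|\cdot|$ is the Euclidean norm. *)

(* Defs.v *)
(* MathComp / MathComp-Analysis *)
From HB Require Import structures.
From mathcomp Require Import all_boot all_order all_algebra.
From mathcomp Require Import all_classical all_reals all_analysis.
From mathcomp Require Import measurable_realfun.

Set Implicit Arguments.
Unset Strict Implicit.
Unset Printing Implicit Defensive.

Import Order.TTheory GRing.Theory Num.Theory.
Import numFieldNormedType.Exports.

Local Open Scope classical_set_scope.
Local Open Scope ring_scope.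

Section linear_algebra.
Context {R : realType}.

Definition dot n (u v : 'cV[R]_n) : R := \sum_(i < n) u i 0 * v i 0.

(* The library norm on matrices is the sup norm, hence this definition. *)
Definition enorm n (u : 'cV[R]_n) : R := Num.sqrt (dot u u).

Definition posdefmx n (A : 'M[R]_n) : Prop :=
  A^T = A /\ forall x : 'cV[R]_n, x != 0 -> 0 < dot x (A *m x).

(* The symmetric positive definite square root; it exists and is unique as soon
   as A is itself symmetric positive definite. *)
Definition sqrtmx n (A : 'M[R]_n) : 'M[R]_n :=
  xget 0 [set B | posdefmx B /\ B *m B = A].

Lemma mxtrace_dot n (A D : 'M[R]_n) :
  D^T = D -> \tr (D *m A *m D) = \sum_i dot (col i D) (A *m col i D).
Proof.
move=> sD; rewrite /mxtrace; apply: eq_bigr => i _.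
rewrite -mulmxA mxE /dot; apply: eq_bigr => j _.
by rewrite !mxE -{1}sD mxE; congr (_ * _); apply: eq_bigr => k _; rewrite !mxE.
Qed.

Lemma sqrtmx_unique n (B1 B2 : 'M[R]_n) :
  posdefmx B1 -> posdefmx B2 -> B1 *m B1 = B2 *m B2 -> B1 = B2.
Proof.
move=> [s1 p1] [s2 p2] B12.
pose D := B1 - B2.
have sD : D^T = D by rewrite /D linearB/= s1 s2.
have ge0 (A : 'M[R]_n) (x : 'cV_n) : posdefmx A -> 0 <= dot x (A *m x).
  move=> [_ pA]; have [->|/pA/ltW//] := eqVneq x 0.
  by rewrite mulmx0 /dot big1// => i _; rewrite mxE mul0r.
have tr0 : \tr (D *m (B1 + B2) *m D) = 0.
  have e : (B1 + B2) *m D = B2 *m B1 - B1 *m B2.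
    by rewrite /D mulmxDl !mulmxBr B12 addrC addrA subrK.
  have e' : D *m (B1 + B2) = B1 *m B2 - B2 *m B1.
    rewrite /D mulmxBl !mulmxDr B12 [X in X - _]addrC opprD.
    by rewrite [X in _ + X]addrC addrA addrK.
  suff: \tr (D *m (B1 + B2) *m D) *+ 2 = 0 by move/eqP; rewrite mulrn_eq0 => /eqP.
  rewrite mulr2n {1}e' -[X in _ + \tr X]mulmxA e [X in _ + X]mxtrace_mulC.
  by rewrite -raddfD/= -mulmxDl addrC addrA subrK subrr mul0mx mxtrace0.
apply/eqP; rewrite -subr_eq0 -/D; apply/eqP/matrixP => i j.
have : \tr (D *m B1 *m D) = 0.
  have n1 : 0 <= \tr (D *m B1 *m D).
    by rewrite mxtrace_dot// sumr_ge0// => k _; apply: ge0.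
  have n2 : 0 <= \tr (D *m B2 *m D).
    by rewrite mxtrace_dot// sumr_ge0// => k _; apply: ge0.
  apply/eqP; rewrite eq_le n1 andbT.
  have := tr0; rewrite (mulmxDr D) (mulmxDl (D *m B1)) raddfD/= => /eqP.
  by rewrite addr_eq0 => /eqP ->; rewrite oppr_le0.
rewrite mxtrace_dot// => /eqP; rewrite psumr_eq0; last by move=> k _; apply: ge0.
move=> /allP /(_ j (mem_index_enum _)) /= /eqP d0.
have [/colP/(_ i)|/p1] := eqVneq (col j D) 0; first by rewrite !mxE.
by rewrite d0 ltxx.
Qed.

(* Points of R^n as carriers of a sigma-algebra are n.-tuple R, whose
   measurable structure is the product (= Borel) one. *)
Definition vec n (t : n.-tuple R) : 'cV[R]_n := \col_(i < n) tnth t i.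

Definition diag n (t : n.-tuple R) : 'M[R]_n := diag_mx (vec t)^T.

End linear_algebra.

Section lebesgue_tuple.
Context {R : realType}.

(* measurableTypeR R is R with the sigma-algebra lebesgue_measure is declared
   on; it has the same measurable sets as R itself. *)
Definition tcons n (p : measurableTypeR R * n.-tuple R) : n.+1.-tuple R :=
  [tuple of (p.1 : R) :: p.2].

Lemma measurable_tcons n : measurable_fun setT (@tcons n).
Proof. by apply: measurable_cons; [exact: measurable_fst|exact: measurable_snd]. Qed.

HB.instance Definition _ n :=
  @isMeasurableFun.Build _ _ _ _ (@tcons n) (@measurable_tcons n).

Section step.
Context n (mu : {sigma_finite_measure set (n.-tuple R) -> \bar R}).

Definition lebesgue_step : set (n.+1.-tuple R) -> \bar R :=
  pushforward (@lebesgue_measure R \x mu)%E (@tcons n).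

Let lebesgue_step0 : lebesgue_step set0 = 0%E.
Proof. exact: measure0. Qed.

Let lebesgue_step_ge0 A : (0 <= lebesgue_step A)%E.
Proof. exact: measure_ge0. Qed.

Let lebesgue_step_sigma_additive : semi_sigma_additive lebesgue_step.
Proof. exact: measure_semi_sigma_additive. Qed.

HB.instance Definition _ := isMeasure.Build _ _ _ lebesgue_step
  lebesgue_step0 lebesgue_step_ge0 lebesgue_step_sigma_additive.

Let lebesgue_step_sigma_finite : sigma_finite setT lebesgue_step.
Proof.
have /sigma_finiteP[F [FT ndF Foo]] := sigma_finiteT (@lebesgue_measure R).
have /sigma_finiteP[G [GT ndG Goo]] := sigma_finiteT mu.
pose u (t : n.+1.-tuple R) : measurableTypeR R * n.-tuple R :=
  (thead t, [tuple of behead t]).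
have uK : cancel (@tcons n) u.
  by move=> [x t]; congr pair; apply: val_inj.
have mu_u : measurable_fun setT u.
  apply/measurable_fun_pair; first exact: measurable_tnth.
  exact: measurable_behead.
exists (fun k => u @^-1` (F k `*` G k)).
  rewrite -preimage_bigcup -[LHS](preimage_setT u); congr (u @^-1` _).
  rewrite -setXTT FT GT; apply/seteqP; split => [[x y]|[x y] [k _ []]/=].
    move=> [/= [a _ Fa] [b _ Gb]]; exists (maxn a b) => //; split.
    - by move: x Fa; exact/subsetPset/ndF/leq_maxl.
    - by move: y Gb; exact/subsetPset/ndG/leq_maxr.
  by move=> Fx Gy; split; exists k.
move=> k; have [mF Fk] := Foo k; have [mG Gk] := Goo k; split.
  by rewrite -[X in measurable X]setTI; apply: mu_u => //; exact: measurableX.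
rewrite /lebesgue_step /pushforward -comp_preimage.
rewrite (_ : u \o _ = id) ?preimage_id; last by apply/funext => p; exact: uK.
by rewrite product_measure1E// lte_mul_pinfty// ge0_fin_numE.
Qed.

HB.instance Definition _ := Measure_isSigmaFinite.Build _ _ _ lebesgue_step
  lebesgue_step_sigma_finite.

End step.

(* n-dimensional Lebesgue measure; in dimension 0 it is the unit mass. *)
Fixpoint lebesgue_tuple n : {sigma_finite_measure set (n.-tuple R) -> \bar R} :=
  match n with
  | 0 => @dirac _ (0.-tuple R) [tuple] R
  | m.+1 => lebesgue_step (lebesgue_tuple m)
  end.

End lebesgue_tuple.

Definition box (R : realType) n (a b : R) : set (n.-tuple R) :=
  [set t | forall i, tnth t i \in `[a, b]].

Lemma box_tcons (R : realType) n (a b : R) :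
  @tcons R n @^-1` @box R n.+1 a b = `[a, b]%classic `*` @box R n a b.
Proof.
apply/seteqP; split => -[x t] /=.
  move=> H; split=> [|i].
    exact: (H ord0).
  by have := H (lift ord0 i); rewrite tnthS.
move=> [/= H1 H2] i; have [->|] := eqVneq i ord0; first by rewrite tnth0.
case: (unliftP ord0 i) => [j ->|->]; last by rewrite eqxx.
by move=> _; rewrite tnthS; exact: H2.
Qed.

Lemma measurable_box (R : realType) n (a b : R) : measurable (@box R n a b).
Proof.
rewrite (_ : @box R n a b = \bigcap_(i in [set: 'I_n]) ((fun t => tnth t i) @^-1` `[a, b]%classic)).
  apply: fin_bigcap_measurable => // i _; rewrite -[X in measurable X]setTI.
  by apply: measurable_tnth => //; exact: measurable_itv.
apply/seteqP; split => t H i /=; first by move=> _; exact: H.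
exact: (H i I).
Qed.

Lemma lebesgue_box (R : realType) n (a b : R) : a < b ->
  lebesgue_tuple n (@box R n a b) = ((b - a) ^+ n)%:E.
Proof.
move=> ab; elim: n => [|n IH].
  by rewrite /= diracE mem_set// => -[].
rewrite [LHS]/= /lebesgue_step /pushforward box_tcons.
rewrite product_measure1E//; last exact: measurable_box.
by rewrite /= IH lebesgue_measure_itv/= lte_fin ab exprS EFinM EFinB.
Qed.

Section uniform_sphere.
Context {R : realType} (n : nat).
Implicit Types t : n.-tuple R.

Definition eball : set (n.-tuple R) := [set t | enorm (vec t) <= 1].

(* t |-> t / |t|, with 0 |-> 0. *)
Definition radial t : n.-tuple R := [tuple tnth t i / enorm (vec t) | i < n].

Lemma measurable_enorm_vec : measurable_fun setT (fun t => enorm (vec t)).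
Proof.
rewrite (_ : (fun t => _) = Num.sqrt \o (fun t => \sum_(i < n) tnth t i ^+ 2)).
  apply: measurableT_comp.
    by apply: continuous_measurable_fun; exact: sqrt_continuous.
  by apply: measurable_sum => i; apply: measurable_funX; exact: measurable_tnth.
apply/funext => t /=; congr Num.sqrt.
by apply: eq_bigr => i _; rewrite mxE expr2.
Qed.

Lemma measurable_eball : measurable eball.
Proof.
rewrite (_ : eball = setT `&` (fun t => enorm (vec t)) @^-1` `]-oo, 1]).
  by apply: measurable_enorm_vec => //; exact: measurable_itv.
by rewrite setTI; apply/seteqP; split=> t /=; rewrite in_itv.
Qed.

Lemma measurable_radial : measurable_fun setT radial.
Proof.
apply/measurable_fun_tnthP => i.
rewrite (_ : _ \o _ = (fun t => tnth t i) \* (fun t => enorm (vec t) `^ (-1))).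
  apply: measurable_funM; first exact: measurable_tnth.
  apply: (measurableT_comp (f := @powR R ^~ (-1))); first exact: measurable_powR.
  exact: measurable_enorm_vec.
by apply/funext => t /=; rewrite tnth_mktuple powR_inv1// sqrtr_ge0.
Qed.

HB.instance Definition _ :=
  @isMeasurableFun.Build _ _ _ _ radial measurable_radial.

(* A |-> vol {t in B | t / |t| \in A}, with B the unit ball of R^n. *)
Definition cone_measure : set (n.-tuple R) -> \bar R :=
  pushforward (mrestr (lebesgue_tuple n) measurable_eball) radial.

Let cone_measure0 : cone_measure set0 = 0%E.
Proof. exact: measure0. Qed.

Let cone_measure_ge0 A : (0 <= cone_measure A)%E.
Proof. exact: measure_ge0. Qed.

Let cone_measure_sigma_additive : semi_sigma_additive cone_measure.
Proof. exact: measure_semi_sigma_additive. Qed.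

HB.instance Definition _ := isMeasure.Build _ _ _ cone_measure
  cone_measure0 cone_measure_ge0 cone_measure_sigma_additive.

(* The uniform probability measure on the unit sphere, as the normalised cone
   measure. The second argument of mnormalize is only used when the total mass
   is 0 or +oo, which does not happen by cone_measureT_gt0_lty below. For
   n > 0 the result is carried by the sphere, {0} being a null set. *)
Definition unif_sphere : probability (n.-tuple R) R :=
  mnormalize cone_measure (@dirac _ (n.-tuple R) [tuple 0 | _ < n] R).

End uniform_sphere.

Lemma cone_measureT_gt0_lty (R : realType) n :
  (0 < @cone_measure R n setT)%E /\ (@cone_measure R n setT < +oo)%E.
Proof.
have -> : @cone_measure R n setT = lebesgue_tuple n (@eball R n).
  by rewrite /cone_measure /pushforward /mrestr preimage_setT setTI.
split.
  have n0 : 0 < n.+1%:R^-1 :> R by rewrite invr_gt0.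
  apply: (@lt_le_trans _ _ (lebesgue_tuple n (@box R n 0 n.+1%:R^-1))).
    by rewrite lebesgue_box// lte_fin exprn_gt0// subr0.
  apply: le_measure; rewrite ?inE; [exact: measurable_box|exact: measurable_eball|].
  move=> t H; rewrite /eball /= /enorm -[leRHS]sqrtr1 ler_wsqrtr//.
  have K : forall i : 'I_n, true -> vec t i 0 * vec t i 0 <= n.+1%:R^-1.
    move=> i _; rewrite mxE; have := H i; rewrite in_itv/= => /andP[h1 h2].
    by rewrite (le_trans (ler_pM h1 h1 h2 h2))// ler_piMr// ?invf_le1// ?ler1n// ltW.
  apply: (@le_trans _ _ (\sum_(i < n) n.+1%:R^-1)); first exact: ler_sum.
  rewrite sumr_const card_ord -[leLHS]mulr_natl.
  by rewrite ler_pdivrMr// mul1r ler_nat.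
apply: (@le_lt_trans _ _ (lebesgue_tuple n (@box R n (-1) 1))); last first.
  by rewrite lebesgue_box ?ltry// (lt_trans _ ltr01)// oppr_lt0.
apply: le_measure; rewrite ?inE; [exact: measurable_eball|exact: measurable_box|].
move=> t; rewrite /eball /= => H i; rewrite in_itv/= -ler_norml.
apply: le_trans H; rewrite -sqrtr_sqr /enorm ler_wsqrtr//.
rewrite /dot (bigD1 i)//= mxE expr2 lerDl sumr_ge0// => j _.
by rewrite -expr2 sqr_ge0.
Qed.

Section rate.
Context {R : realType}.

Definition normalize n (w : 'cV[R]_n) : 'cV[R]_n := (enorm w)^-1 *: w.

(* The random variable below is measurable with values in [0, 1], so its
   expectation is finite and the infimum is that of a nonempty set of
   nonnegative reals (for n > 0). *)
Definition rho n (C : 'M[R]_n) : R :=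
  2^-1 * inf [set fine ('E_(unif_sphere n)
                 [fun v => dot zeta (normalize (sqrtmx (invmx C) *m vec v)) ^+ 2])
             | zeta in [set zeta : 'cV[R]_n | enorm zeta = 1]].

Definition asymp (f g : R -> R) : Prop :=
  exists k c C : R, [/\ 0 < k, 0 < c, 0 < C &
    forall x, k <= x -> c * g x <= f x <= C * g x].

End rate.

(* Main.v *)
Require Import Defs.
From mathcomp Require Import all_boot all_order all_algebra.
From mathcomp Require Import all_classical all_reals all_analysis.
From mathcomp Require Import measurable_realfun ring lra.
Import Order.TTheory GRing.Theory Num.Theory.
Import numFieldNormedType.Exports.
Local Open Scope ring_scope.
Set Implicit Arguments.
Unset Strict Implicit.
Unset Printing Implicit Defensive.

(** The Rayleigh quotient [(zeta . w)^2 / |w|^2], [w = C^(-1/2) v], is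
    homogeneous of degree 0, so its mean over the sphere is its mean over the
    unit ball. Up to constants the ball may be replaced by a cube, on which the
    integrals can be iterated. With [s = kappa^(-1/2)], the upper bounds come from
    the unit vector [zeta = e_1] and reduce to the integrals of
    [s^2 / (s + |t_1| + ... + |t_m|)^2] over [[-1, 1]^m], where [m] is the number
    of eigenvalues of [C] equal to 1: they are of order [s], [s^2 log (1/s)] and
    [s^2] for [m = 1, 2, 3]. The same integrals over [[0, 1/2]^m] give the lower
    bounds. *)

(** The orders of the integrals can be read off in polar form: the integrand behaves like
    $r^{m-1}/(s+r)^2$ at radius $r$. For $m=1$ the scale $r\sim s$ dominates, for $m=2$ all scales
    between $s$ and 1 contribute equally and produce the logarithm, for $m=3$ the mass sits at
    $r\sim1$. The lower bound has to hold for every $\zeta$, including those mixing large and small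
    weights. On a suitable orthant the quotient dominates $\sum_i\zeta_i^2$ times the share of
    coordinate $i$ in $|w|^2$, a convex combination, so bounding each coordinate separately is
    enough. Coordinates of weight 1 have a share of order 1; those of weight $s$ decide the rate.
    The ball lies in $[-1,1]^n$ and contains $[0,1/2]^n$ as long as $n\le4$. Its volume is never
    computed: being positive and finite, it is absorbed in the constants. *)

Lemma measurable_funVr d (T : measurableType d) (R : realType) (D : set T)
  (f : T -> R) : measurable_fun D f -> measurable_fun D (fun x => (f x)^-1).
Proof.
move=> mf.
(* The power [-1] is known to agree with the inverse only on nonnegative reals, hence the square; at
   a zero of [f] both sides are 0. *)
rewrite (_ : (fun x => (f x)^-1) = f \* (fun x => (f x ^+ 2) `^ (-1))).
  apply: measurable_funM => //.
  apply: (measurableT_comp (f := @powR R ^~ (-1))); first exact: measurable_powR.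
  exact: measurable_funX.
apply/funext => x /=; rewrite powR_inv1 ?sqr_ge0// expr2 invfM.
have [->|f0] := eqVneq (f x) 0; first by rewrite invr0 mul0r.
by rewrite mulrA mulfV// mul1r.
Qed.

(** * Lebesgue measure on tuples: iterated integrals and reflections *)

Section lebesgue_oppr.
Local Open Scope ereal_scope.
Context {R : realType}.
Let mu := @lebesgue_measure R.

Lemma ge0_integral_oppr (f : R -> \bar R) : measurable_fun setT f ->
  (forall x, 0 <= f x) ->
  \int[mu]_x f (- x)%R = \int[mu]_x f x.
Proof.
move=> mf f0.
transitivity (\int[pushforward mu (-%R : _ -> measurableTypeR R)]_x f x).
  by rewrite ge0_integral_pushforward//= preimage_setT.
by apply: eq_measure_integral => A mA _; exact: lebesgue_measureN.
Qed.

End lebesgue_oppr.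

Section tuple_integral.
Local Open Scope ereal_scope.
Context {R : realType}.
Let mu := @lebesgue_measure R.
Let lam n : {measure set (n.-tuple R) -> \bar R} := lebesgue_tuple n.

Lemma measurable_tcons2 n d (T : measurableType d) (f : n.+1.-tuple R -> T) x :
  measurable_fun setT f -> measurable_fun setT (fun t => f (tcons (x, t))).
Proof.
move=> mf; apply: (measurableT_comp mf).
by apply: (measurableT_comp (@measurable_tcons R n)); exact: measurable_pair1.
Qed.

Lemma ge0_integral_tupleS n (f : n.+1.-tuple R -> \bar R) :
  measurable_fun setT f -> (forall t, 0 <= f t) ->
  \int[lam n.+1]_t f t = \int[mu]_x \int[lam n]_t f (tcons (x, t)).
Proof.
move=> mf f0; rewrite /lam/= /lebesgue_step ge0_integral_pushforward//=.
rewrite preimage_setT fubini_tonelli1//.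
by apply: measurableT_comp => //; exact: measurable_tcons.
Qed.

Lemma measurable_integral_tcons n (f : n.+1.-tuple R -> \bar R) :
  measurable_fun setT f -> (forall t, 0 <= f t) ->
  measurable_fun setT (fun x => \int[lam n]_t f (tcons (x, t))).
Proof.
move=> mf f0.
apply: (@measurable_fun_fubini_tonelli_F _ _ _ _ _ (lebesgue_tuple n)
  (f \o @tcons R n)); last by move=> p; exact: f0.
by apply: measurableT_comp => //; exact: measurable_tcons.
Qed.

Lemma integral_tuple0 (f : 0.-tuple R -> \bar R) :
  measurable_fun setT f ->
  \int[lam 0]_t f t = f [tuple].
Proof. by move=> mf; rewrite /lam/= integral_dirac// diracT mul1e. Qed.

(** The product of [A] and [B] carried over to tuples, the shape in which cubes are integrated one
    coordinate at a time. *)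
Definition consset n (A : set R) (B : set (n.-tuple R)) : set (n.+1.-tuple R) :=
  [set t | A (thead t) /\ B [tuple of behead t]].

Lemma measurable_consset n (A : set R) (B : set (n.-tuple R)) :
  measurable A -> measurable B -> measurable (consset A B).
Proof.
move=> mA mB; apply: measurableI.
  by rewrite -[X in measurable X]setTI; apply: measurable_tnth.
by rewrite -[X in measurable X]setTI; apply: measurable_behead.
Qed.

Lemma consset_tcons n (A : set R) (B : set (n.-tuple R)) x t :
  consset A B (tcons (x, t)) = (A x /\ B t).
Proof.
rewrite /consset /= theadE; congr (_ /\ B _); exact: val_inj.
Qed.

Lemma ge0_integral_consset n (A : set R) (B : set (n.-tuple R))
    (f : n.+1.-tuple R -> \bar R) :
  measurable A -> measurable B ->
  measurable_fun setT f -> (forall t, 0 <= f t) ->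
  \int[lam n.+1]_(t in consset A B) f t =
  \int[mu]_(x in A) \int[lam n]_(t in B) f (tcons (x, t)).
Proof.
move=> mA mB mf f0; have mAB := measurable_consset mA mB.
rewrite integral_mkcond ge0_integral_tupleS; last 2 first.
- by apply/(measurable_restrictT _ mAB); exact: measurable_funTS.
- by move=> t; apply: erestrict_ge0.
rewrite [RHS]integral_mkcond; apply: eq_integral => x _.
rewrite patchE; case: ifPn => xA; last first.
  apply: integral0_eq => t _; rewrite patchE ifF//.
  by apply/negbTE; rewrite notin_setE consset_tcons => -[]; rewrite notin_setE in xA.
rewrite [RHS]integral_mkcond; apply: eq_integral => t _; rewrite !patchE.
suff -> : (tcons (x, t) \in consset A B) = (t \in B) by [].
apply/idP/idP; rewrite !inE consset_tcons; first by case.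
by move=> Bt; split => //; rewrite inE in xA.
Qed.

Definition reflect_tuple n (e : 'I_n -> bool) (t : n.-tuple R) : n.-tuple R :=
  [tuple ((-1) ^+ e i * tnth t i)%R | i < n].

Lemma measurable_reflect_tuple n (e : 'I_n -> bool) :
  measurable_fun setT (reflect_tuple e).
Proof.
apply/measurable_fun_tnthP => i.
rewrite (_ : _ \o _ = (fun t => (-1) ^+ e i * tnth t i)%R).
  by apply: measurable_funM => //; exact: measurable_tnth.
by apply/funext => t /=; rewrite tnth_mktuple.
Qed.

Lemma ge0_integral_reflect n (e : 'I_n -> bool) (f : n.-tuple R -> \bar R) :
  measurable_fun setT f -> (forall t, 0 <= f t) ->
  \int[lam n]_t f (reflect_tuple e t) = \int[lam n]_t f t.
Proof.
elim: n e f => [|n IH] e f mf f0.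
  by apply: eq_integral => t _; congr f; rewrite tuple0 [RHS]tuple0.
have mfe : measurable_fun setT (f \o reflect_tuple e).
  by apply: measurableT_comp => //; exact: measurable_reflect_tuple.
rewrite !ge0_integral_tupleS//=.
(* For each fixed head the induction hypothesis undoes the reflection of the tail; what remains is a
   sign change of one real variable. *)
transitivity (\int[mu]_x \int[lam n]_t f (tcons ((-1) ^+ e ord0 * x, t)%R)).
  apply: eq_integral => x _.
  rewrite -(IH (e \o lift ord0)) //; last exact: measurable_tcons2.
  apply: eq_integral => t _; congr f; apply: eq_from_tnth => i.
  rewrite tnth_mktuple; have [->|] := eqVneq i ord0; first by rewrite !tnth0.
  case: (unliftP ord0 i) => [j ->|->]; last by rewrite eqxx.
  by rewrite !tnthS tnth_mktuple.
case: (e ord0); last by under eq_integral do rewrite expr0 mul1r.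
under eq_integral do rewrite expr1 mulN1r.
apply: (ge0_integral_oppr (f := fun x => \int[lam n]_t f (tcons (x, t)))).
- exact: measurable_integral_tcons.
- by move=> x; apply: integral_ge0.
Qed.

End tuple_integral.

(** Cauchy-Schwarz against the all-ones vector, by summing $u_iu_j\le(u_i^2+u_j^2)/2$ over all
    pairs. *)
Lemma sqr_sum_le (R : realFieldType) n (u : 'I_n -> R) :
  (\sum_i u i) ^+ 2 <= n%:R * \sum_i u i ^+ 2.
Proof.
rewrite expr2 big_distrlr/=.
apply: (@le_trans _ _ (\sum_i \sum_j (u i ^+ 2 + u j ^+ 2) / 2)).
  apply: ler_sum => i _; apply: ler_sum => j _.
  rewrite -subr_ge0 (_ : _ - _ = (u i - u j) ^+ 2 / 2); last by field.
  by rewrite divr_ge0// sqr_ge0.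
rewrite (eq_bigr (fun i => (u i ^+ 2 *+ n + \sum_j u j ^+ 2) / 2)) => [|i _].
  by rewrite -mulr_suml big_split/= sumr_const card_ord sumrMnl -mulr_natl; lra.
by rewrite -mulr_suml big_split/= sumr_const card_ord.
Qed.

(** The off-diagonal terms of the expanded square are nonnegative. *)
Lemma sum_sqr_le_sqr_sum (R : realFieldType) n (u : 'I_n -> R) :
  (forall i, 0 <= u i) -> \sum_i u i ^+ 2 <= (\sum_i u i) ^+ 2.
Proof.
move=> u0; rewrite expr2 big_distrlr/=; apply: ler_sum => i _.
by rewrite (bigD1 i)//= expr2 lerDl sumr_ge0// => j _; rewrite mulr_ge0.
Qed.

(** * The inverse square root of a diagonal covariance *)

Section diagonal.
Context {R : realType}.

Lemma posdef_diag_mx n (d : 'rV[R]_n) :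
  (forall i, 0 < d 0 i) -> posdefmx (diag_mx d).
Proof.
move=> d0; split; first by rewrite tr_diag_mx.
move=> x x0; have [i xi0] : exists i, x i 0 != 0.
  apply/existsP; apply: contra_neqT x0; rewrite negb_exists => /forallP x0.
  by apply/colP => i; apply/eqP; move: (x0 i); rewrite negbK mxE.
rewrite /dot mul_diag_mx (bigD1 i)//= ltr_pwDl//.
  by rewrite !mxE mulrCA mulr_gt0// -expr2 exprn_even_gt0.
apply: sumr_ge0 => j _.
by rewrite !mxE mulrCA -expr2 mulr_ge0 ?sqr_ge0// ltW.
Qed.

(** Since [sqrtmx] is a choice among the positive definite roots, exhibiting one root is not enough:
    [sqrtmx_unique] shows that the choice must be this one. *)
Lemma sqrtmx_invmx_diag n (c : n.-tuple R) : (forall i, 0 < tnth c i) ->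
  sqrtmx (invmx (diag c)) = diag_mx (\row_i (Num.sqrt (tnth c i))^-1).
Proof.
move=> c0; set d := \row_i _.
have pd : posdefmx (diag_mx d).
  by apply: posdef_diag_mx => i; rewrite mxE invr_gt0 sqrtr_gt0.
have dd : diag_mx d *m diag_mx d = invmx (diag c).
  have cdd : diag c *m (diag_mx d *m diag_mx d) = 1%:M.
    rewrite /diag !mulmx_diag -diag_const_mx; congr diag_mx.
    apply/rowP => i; rewrite !mxE -invfM -expr2 sqr_sqrtr ?(ltW (c0 i))//.
    by rewrite divff// gt_eqF.
  have [cu _] := mulmx1_unit cdd.
  by rewrite -[LHS](mulKmx cu) cdd mulmx1.
rewrite /sqrtmx; apply: xget_subset1; first by split.
move=> B1 B2 [p1 e1] [p2 e2]; apply: sqrtmx_unique => //.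
by rewrite e1 e2.
Qed.

End diagonal.

(** * From the sphere to the unit ball *)

Section sphere_integral.
Local Open Scope ereal_scope.
Context {R : realType} (n : nat).
Let lam : {measure set (n.-tuple R) -> \bar R} := lebesgue_tuple n.

Definition ball_volume : R := fine (lam (@eball R n)).

Let cone_measureTE : @cone_measure R n setT = ball_volume%:E.
Proof.
have [h0 hoo] := @cone_measureT_gt0_lty R n.
have -> : ball_volume = fine (@cone_measure R n setT).
  by rewrite /cone_measure /pushforward /mrestr preimage_setT setTI.
by rewrite fineK// ge0_fin_numE.
Qed.

Lemma ball_volume_gt0 : (0 < ball_volume)%R.
Proof.
have [h0 _] := @cone_measureT_gt0_lty R n.
by move: h0; rewrite cone_measureTE lte_fin.
Qed.

Lemma ge0_integral_mrestr (D : set (n.-tuple R)) (mD : measurable D)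
    (f : n.-tuple R -> \bar R) :
  measurable_fun setT f -> (forall t, 0 <= f t) ->
  \int[mrestr lam mD]_t f t = \int[lam]_(t in D) f t.
Proof.
move=> mf f0; rewrite -(setUv D) ge0_integral_setU//; first last.
- by rewrite disj_set2E setICr.
- by rewrite setUv.
- exact: measurableC.
have -> : \int[mrestr lam mD]_(t in ~` D) f t = 0.
  rewrite (eq_measure_integral mzero) ?integral_measure_zero// => A mA AD.
  rewrite /= /mrestr /mzero (_ : A `&` D = set0)%classic ?measure0//.
  by apply/seteqP; split => // t [/AD].
rewrite adde0; apply: eq_measure_integral => A mA AD.
by rewrite /= /mrestr setIidl.
Qed.

(** The sphere measure is a normalised push-forward of the ball along [radial], and a function
    invariant under [radial] does not see the push-forward. *)
Lemma ge0_integral_unif_sphere (f : n.-tuple R -> \bar R) :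
  measurable_fun setT f -> (forall t, 0 <= f t) ->
  (forall t, f (radial t) = f t) ->
  \int[unif_sphere n]_t f t =
  (ball_volume^-1)%:E * \int[lam]_(t in @eball R n) f t.
Proof.
move=> mf f0 fr; have V0 := ball_volume_gt0.
have kge0 : (0 <= ball_volume^-1)%R by rewrite invr_ge0 ltW.
transitivity (\int[mscale (NngNum kge0) (@cone_measure R n)]_t f t).
  apply: eq_measure_integral => A mA _.
  rewrite /unif_sphere /= /mnormalize /= cone_measureTE /=.
  (* The total mass is a positive real, so [mnormalize] takes its dividing branch and not the
     default measure. *)
  rewrite /mscale /= ifF; last by rewrite orbF eqe gt_eqF.
  by rewrite muleC.
rewrite ge0_integral_mscale//=; congr (_ * _).
rewrite ge0_integral_pushforward//= preimage_setT.
under eq_integral do rewrite fr.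
by rewrite ge0_integral_mrestr.
Qed.

End sphere_integral.

(** * Bounding the rate by integrals over cubes *)

Section rate_bounds.
Context {R : realType} (n : nat).
Let lam : {measure set (n.-tuple R) -> \bar R} := lebesgue_tuple n.
Implicit Types (a : 'I_n -> R) (t : n.-tuple R).

Definition weight (c : n.-tuple R) (i : 'I_n) : R := (Num.sqrt (tnth c i))^-1.

Definition rayleigh a (zeta : 'cV[R]_n) t : R :=
  (\sum_i zeta i 0 * (a i * tnth t i)) ^+ 2 / \sum_i (a i * tnth t i) ^+ 2.

(** The part of $|w|^2$ carried by coordinate [i], where $w_j=a_jt_j$; it is the Rayleigh quotient
    at the [i]-th basis vector. *)
Definition share a i t : R :=
  (a i * tnth t i) ^+ 2 / \sum_j (a j * tnth t j) ^+ 2.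

Lemma measurable_rayleigh a zeta : measurable_fun setT (rayleigh a zeta).
Proof.
apply: measurable_funM; last apply: measurable_funVr.
  apply: measurable_funX; apply: measurable_sum => i.
  by do 2 apply: measurable_funM => //; exact: measurable_tnth.
apply: measurable_sum => i; apply: measurable_funX.
by apply: measurable_funM => //; exact: measurable_tnth.
Qed.

Lemma measurable_share a i : measurable_fun setT (share a i).
Proof.
apply: measurable_funM; last apply: measurable_funVr.
  by apply: measurable_funX; apply: measurable_funM => //; exact: measurable_tnth.
apply: measurable_sum => j; apply: measurable_funX.
by apply: measurable_funM => //; exact: measurable_tnth.
Qed.

Let den_ge0 a t : 0 <= \sum_j (a j * tnth t j) ^+ 2.
Proof. by apply: sumr_ge0 => j _; exact: sqr_ge0. Qed.

Lemma rayleigh_ge0 a zeta t : 0 <= rayleigh a zeta t.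
Proof. by rewrite divr_ge0// sqr_ge0. Qed.

Lemma share_ge0 a i t : 0 <= share a i t.
Proof. by rewrite divr_ge0// sqr_ge0. Qed.

Lemma rayleigh_radial a zeta t : rayleigh a zeta (radial t) = rayleigh a zeta t.
Proof.
(* At the origin no scaling factor can be cancelled, but [radial] fixes this point. *)
have [t0|t0] := eqVneq (enorm (vec t)) 0.
  congr rayleigh; apply: eq_from_tnth => i; rewrite tnth_mktuple t0 invr0 mulr0.
  apply/esym/eqP; rewrite -sqrf_eq0 -[_ == _]andTb; apply/eqP.
  move/eqP: t0; rewrite sqrtr_eq0 => t0.
  apply/eqP; rewrite eq_le sqr_ge0 andbT /=; apply: le_trans t0.
  rewrite /dot (bigD1 i)//= mxE expr2 lerDl sumr_ge0// => j _.
  by rewrite -expr2 sqr_ge0.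
rewrite /rayleigh.
have -> : \sum_i (a i * tnth (radial t) i) ^+ 2 =
          (enorm (vec t))^-1 ^+ 2 * \sum_i (a i * tnth t i) ^+ 2.
  by rewrite mulr_sumr; apply: eq_bigr => i _; rewrite tnth_mktuple; ring.
have -> : \sum_i zeta i 0 * (a i * tnth (radial t) i) =
          (enorm (vec t))^-1 * \sum_i zeta i 0 * (a i * tnth t i).
  by rewrite mulr_sumr; apply: eq_bigr => i _; rewrite tnth_mktuple; ring.
rewrite exprMn -mulf_div divff ?mul1r//.
by rewrite expf_neq0// invr_neq0.
Qed.

(** Serves only to make the integral in [rho_ge] finite, so a crude bound by Cauchy-Schwarz is
    enough. *)
Lemma rayleigh_le a (zeta : 'cV[R]_n) t : (forall i, zeta i 0 ^+ 2 <= 1) ->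
  rayleigh a zeta t <= n%:R.
Proof.
move=> z1; rewrite /rayleigh.
have [->|d0] := eqVneq (\sum_j (a j * tnth t j) ^+ 2) 0.
  by rewrite invr0 mulr0 ler0n.
rewrite ler_pdivrMr ?lt_def ?d0//=; apply: le_trans (sqr_sum_le _) _.
rewrite ler_wpM2l// ?ler0n//; apply: ler_sum => i _.
by rewrite exprMn ler_piMl// sqr_ge0.
Qed.

Lemma expectation_rayleigh (c : n.-tuple R) (zeta : 'cV[R]_n) :
  (forall i, 0 < tnth c i) ->
  ('E_(unif_sphere n)
    [fun v => dot zeta (normalize (sqrtmx (invmx (diag c)) *m vec v)) ^+ 2]%R =
  (ball_volume n)^-1%:E * \int[lam]_(t in @eball R n)
     (rayleigh (weight c) zeta t)%:E)%E.
Proof.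
move=> c0; set a := weight c.
rewrite -ge0_integral_unif_sphere.
- rewrite unlock; apply: eq_integral => t _; congr EFin.
  rewrite sqrtmx_invmx_diag// /dot /normalize /rayleigh.
  set w := diag_mx _ *m _.
  have we i : w i 0 = a i * tnth t i by rewrite /w mul_diag_mx !mxE /a /weight.
  have -> : \sum_i (a i * tnth t i) ^+ 2 = enorm w ^+ 2.
    rewrite sqr_sqrtr; last by apply: sumr_ge0 => i _; rewrite -expr2 sqr_ge0.
    by apply: eq_bigr => i _; rewrite we expr2.
  rewrite -exprVn -exprMn mulr_suml; congr (_ ^+ 2); apply: eq_bigr => i _.
  by rewrite mxE we; ring.
- by apply/measurable_EFinP; exact: measurable_rayleigh.
- by move=> t; rewrite lee_fin rayleigh_ge0.
- by move=> t; rewrite rayleigh_radial.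
Qed.

Lemma enorm_eq1 (zeta : 'cV[R]_n) : enorm zeta = 1 -> \sum_i zeta i 0 ^+ 2 = 1.
Proof.
move=> z1; have := congr1 (fun x => x ^+ 2) z1.
rewrite expr1n /enorm sqr_sqrtr; last first.
  by apply: sumr_ge0 => i _; rewrite -expr2 sqr_ge0.
by move=> <-; apply: eq_bigr => i _; rewrite expr2.
Qed.

Lemma enorm_delta (i : 'I_n) : enorm (delta_mx i 0 : 'cV[R]_n) = 1.
Proof.
rewrite /enorm /dot (bigD1 i)//= big1 ?addr0 => [|j ji].
  by rewrite !mxE !eqxx mulr1 sqrtr1.
by rewrite !mxE (negbTE ji) mul0r.
Qed.

Lemma rayleigh_delta a (i : 'I_n) t : rayleigh a (delta_mx i 0) t = share a i t.
Proof.
rewrite /rayleigh /share; congr (_ ^+ 2 / _).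
rewrite (bigD1 i)//= big1 ?addr0 => [|j ji]; first by rewrite mxE !eqxx mul1r.
by rewrite mxE (negbTE ji) mul0r.
Qed.

Lemma eball_sub_box : (@eball R n `<=` @box R n (-1) 1)%classic.
Proof.
move=> t; rewrite /eball /= => H i; rewrite in_itv/= -ler_norml.
apply: le_trans H; rewrite -sqrtr_sqr /enorm ler_wsqrtr//.
rewrite /dot (bigD1 i)//= mxE expr2 lerDl sumr_ge0// => j _.
by rewrite -expr2 sqr_ge0.
Qed.

Section given_covariance.
Variable c : n.-tuple R.
Hypothesis c0 : forall i, 0 < tnth c i.
Let a := weight c.

(** The infimum is tested at the [i]-th basis vector, and the ball is enlarged to the cube because
    the integrand is nonnegative. *)
Lemma rho_le i (U : R) :
  (\int[lam]_(t in @box R n (-1) 1) (share (weight c) i t)%:E <= U%:E)%E ->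
  rho (diag c) <= U / (2 * ball_volume n).
Proof.
move=> HU; have V0 := @ball_volume_gt0 R n.
rewrite invfM mulrCA; apply: ler_wpM2l; first by rewrite invr_ge0.
have J0 z : (0 <= (ball_volume n)^-1%:E *
    \int[lam]_(t in @eball R n) (rayleigh a z t)%:E)%E.
  rewrite mule_ge0 ?lee_fin ?invr_ge0 ?(ltW V0)//.
  by apply: integral_ge0 => t _; rewrite lee_fin rayleigh_ge0.
have HJ : ((ball_volume n)^-1%:E * \int[lam]_(t in @eball R n)
    (rayleigh a (delta_mx i 0) t)%:E <= (U * (ball_volume n)^-1)%:E)%E.
  rewrite mulrC EFinM lee_wpmul2l ?lee_fin ?invr_ge0 ?(ltW V0)//.
  apply: le_trans HU; under eq_integral do rewrite rayleigh_delta.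
  apply: ge0_subset_integral.
  - exact: measurable_eball.
  - exact: measurable_box.
  - by apply/measurable_funTS/measurable_EFinP; exact: measurable_share.
  - by move=> t _; rewrite lee_fin share_ge0.
  - exact: eball_sub_box.
apply: le_trans (_ : _ <= fine ((ball_volume n)^-1%:E * \int[lam]_(t in @eball R n)
    (rayleigh a (delta_mx i 0) t)%:E)%E) _.
  apply: ge_inf.
    exists 0 => _ [z _ <-]; rewrite expectation_rayleigh//.
    by rewrite fine_ge0.
  exists (delta_mx i 0); first exact: enorm_delta.
  by rewrite expectation_rayleigh.
(* [fine] can be removed only from a finite value; [HJ] itself supplies the finiteness. *)
rewrite -lee_fin fineK// ge0_fin_numE//; exact: le_lt_trans HJ (ltry _).
Qed.

Lemma rayleigh_ge (zeta : 'cV[R]_n) t : (forall i, 0 <= zeta i 0 * tnth t i) ->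
  \sum_i zeta i 0 ^+ 2 * share a i t <= rayleigh a zeta t.
Proof.
move=> zt; rewrite /share /rayleigh; under eq_bigr do rewrite mulrA.
rewrite -mulr_suml ler_wpM2r ?invr_ge0//.
under eq_bigr do rewrite -exprMn.
apply: sum_sqr_le_sqr_sum => i.
by rewrite mulrCA mulr_ge0// invr_ge0 sqrtr_ge0.
Qed.

(* Instead of using that the mixed second moments vanish, restrict the integral
   to the orthant on which all the [zeta i * t i] are nonnegative. *)
Lemma rho_ge (L : R) : (0 < n <= 4)%N ->
  (forall i, L%:E <= \int[lam]_(t in @box R n 0 2^-1) (share (weight c) i t)%:E)%E ->
  L / (2 * ball_volume n) <= rho (diag c).
Proof.
move=> /andP[n0 n4] HL; have V0 := @ball_volume_gt0 R n.
rewrite invfM mulrCA; apply: ler_wpM2l; first by rewrite invr_ge0.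
apply: lb_le_inf.
  exists (fine ('E_(unif_sphere n) [fun v => dot (delta_mx (Ordinal n0) 0)
    (normalize (sqrtmx (invmx (diag c)) *m vec v)) ^+ 2]%R)%E).
  by exists (delta_mx (Ordinal n0) 0) => //; exact: enorm_delta.
move=> _ [z z1 <-]; rewrite expectation_rayleigh//.
have {}z1 : \sum_i z i 0 ^+ 2 = 1 by exact: enorm_eq1.
have J0 : (0 <= \int[lam]_(t in @eball R n) (rayleigh a z t)%:E)%E.
  by apply: integral_ge0 => t _; rewrite lee_fin rayleigh_ge0.
(* [fine] sends [+oo] to 0, so an infinite integral would destroy the lower bound. *)
have Jfin : (\int[lam]_(t in @eball R n) (rayleigh a z t)%:E)%E \is a fin_num.
  rewrite ge0_fin_numE//.
  apply: (@le_lt_trans _ _ (\int[lam]_(t in @eball R n) (n%:R)%:E)%E).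
    apply: ge0_le_integral => //.
    - exact: measurable_eball.
    - by move=> t _; rewrite lee_fin rayleigh_ge0.
    - by apply/measurable_funTS/measurable_EFinP; exact: measurable_rayleigh.
    - move=> t _; rewrite lee_fin; apply: rayleigh_le => i.
      rewrite -z1 (bigD1 i)//= lerDl sumr_ge0// => j _; exact: sqr_ge0.
  rewrite integral_cst; last exact: measurable_eball.
  rewrite lte_mul_pinfty ?lee_fin ?ler0n//.
  have [_] := @cone_measureT_gt0_lty R n.
  by rewrite /cone_measure /pushforward /mrestr preimage_setT setTI.
rewrite -(fineK Jfin) -EFinM /= mulrC ler_wpM2l ?invr_ge0 ?(ltW V0)//.
rewrite -lee_fin fineK//.
pose e i := z i 0 < 0.
(* The cube of side 1/2 in the orthant given by the signs of [z]. *)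
pose Q : set (n.-tuple R) := (reflect_tuple e @^-1` @box R n 0 2^-1)%classic.
have mQ : measurable Q.
  by rewrite -[Q]setTI; apply: measurable_reflect_tuple => //; exact: measurable_box.
(* Each coordinate has square at most 1/4, so $|t|^2\le n/4\le1$: this is where $n\le4$ enters. *)
have QB : (Q `<=` @eball R n)%classic.
  move=> t Qt; rewrite /eball /= /enorm -[leRHS]sqrtr1 ler_wsqrtr//.
  have K : forall i : 'I_n, true -> vec t i 0 * vec t i 0 <= 4^-1.
    move=> i _; rewrite mxE; have := Qt i; rewrite tnth_mktuple in_itv/=.
    by case: (e i); rewrite ?expr0 ?expr1 => /andP[h1 h2]; nra.
  apply: (@le_trans _ _ (\sum_(i < n) 4^-1)); first exact: ler_sum.
  rewrite sumr_const card_ord -[leLHS]mulr_natl ler_pdivrMr// mul1r.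
  by rewrite (ler_nat _ n 4).
pose S t := \sum_i z i 0 ^+ 2 * share a i t.
have mS : measurable_fun setT S.
  by apply: measurable_sum => i; apply: measurable_funM => //; exact: measurable_share.
have S0 t : 0 <= S t.
  by apply: sumr_ge0 => i _; rewrite mulr_ge0 ?share_ge0 ?sqr_ge0.
apply: (@le_trans _ _ (\int[lam]_(t in Q) (S t)%:E)%E); last first.
  apply: (@le_trans _ _ (\int[lam]_(t in Q) (rayleigh a z t)%:E)%E).
    apply: ge0_le_integral => //.
    - by move=> t _; rewrite lee_fin.
    - exact/measurable_funTS/measurable_EFinP.
    - by apply/measurable_funTS/measurable_EFinP; exact: measurable_rayleigh.
    - move=> t Qt; rewrite lee_fin; apply: rayleigh_ge => i.
      have := Qt i; rewrite tnth_mktuple in_itv/= /e.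
      by case: ltP => zi; rewrite ?expr0 ?expr1 => /andP[h1 h2]; nra.
  apply: ge0_subset_integral => //.
  - exact: measurable_eball.
  - by apply/measurable_funTS/measurable_EFinP; exact: measurable_rayleigh.
  - by move=> t _; rewrite lee_fin rayleigh_ge0.
(* Shares involve only squares of coordinates, so reflecting [Q] onto the positive cube leaves the
   integrand unchanged. *)
have -> : (\int[lam]_(t in Q) (S t)%:E = \int[lam]_(t in @box R n 0 2^-1) (S t)%:E)%E.
  have mB := @measurable_box R n 0 2^-1.
  rewrite integral_mkcond [RHS]integral_mkcond.
  rewrite -[RHS](ge0_integral_reflect e); last 2 first.
  - by apply/(measurable_restrictT _ mB)/measurable_funTS/measurable_EFinP.
  - by move=> t; apply: erestrict_ge0 => s _; rewrite lee_fin.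
  apply: eq_integral => t _; rewrite !patchE.
  have -> : (reflect_tuple e t \in @box R n 0 2^-1) = (t \in Q).
    by apply/idP/idP; rewrite !inE.
  case: ifP => // _; congr EFin; apply: eq_bigr => i _; congr (_ * _).
  have sq j : (a j * tnth (reflect_tuple e t) j) ^+ 2 = (a j * tnth t j) ^+ 2.
    by rewrite tnth_mktuple; case: (e j); rewrite ?expr0 ?expr1; ring.
  by rewrite /share sq; congr (_ / _); apply: eq_bigr => j _; rewrite sq.
under eq_integral do rewrite /S -sumEFin.
rewrite ge0_integral_sum//; last 3 first.
- exact: measurable_box.
- move=> i; apply/measurable_funTS/measurable_EFinP.
  by apply: measurable_funM => //; exact: measurable_share.
- by move=> i t _; rewrite lee_fin mulr_ge0 ?share_ge0 ?sqr_ge0.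
(* The weights $\zeta_i^2$ sum to 1, so the bound [L] may be distributed over the coordinates. *)
have -> : L = \sum_i z i 0 ^+ 2 * L by rewrite -mulr_suml z1 mul1r.
rewrite -sumEFin; apply: lee_sum => i _.
under eq_integral do rewrite EFinM.
rewrite ge0_integralZl//; last 4 first.
- exact: measurable_box.
- by apply/measurable_funTS/measurable_EFinP; exact: measurable_share.
- by move=> t _; rewrite lee_fin share_ge0.
- by rewrite lee_fin sqr_ge0.
by rewrite EFinM lee_wpmul2l ?lee_fin ?sqr_ge0.
Qed.

End given_covariance.
End rate_bounds.

(** * One-dimensional integrals *)

Section one_dimensional.
Context {R : realType}.
Let mu := @lebesgue_measure R.

Lemma integral_is_derive (F f : R -> R) (a b : R) : a < b ->
  (forall x, a <= x <= b -> is_derive x 1 F (f x)) ->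
  (forall x, a <= x <= b -> {for x, continuous f}) ->
  (\int[mu]_(x in `[a, b]) (f x)%:E = (F b - F a)%:E)%E.
Proof.
move=> ab dF cf.
have cF x : a <= x <= b -> {for x, continuous F}.
  by move=> /dF dx; apply: differentiable_continuous; apply/derivable1_diffP.
rewrite (@continuous_FTC2 _ f F)//.
- apply: continuous_in_subspaceT => x; rewrite inE /= in_itv/=; exact: cf.
- split.
  + move=> x; rewrite in_itv/= => /andP[/ltW ax /ltW xb].
    by have /dF[] : a <= x <= b by rewrite ax xb.
  + by apply: cvg_at_right_filter; apply: cF; rewrite lexx ltW.
  + by apply: cvg_at_left_filter; apply: cF; rewrite lexx ltW.
- move=> x; rewrite in_itv/= => /andP[/ltW ax /ltW xb].
  have dx : is_derive x 1 F (f x) by apply: dF; rewrite ax xb.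
  by rewrite derive1E derive_val.
Qed.

Lemma integral_inv_sqr (A b : R) : 0 < A -> 0 < b ->
  (\int[mu]_(x in `[0%R, b]) (((A + x) ^+ 2)^-1)%:E = (A^-1 - (A + b)^-1)%:E)%E.
Proof.
move=> A0 b0.
have Ax (x : R) : 0 <= x <= b -> A + x != 0.
  by move=> /andP[x0 _]; rewrite gt_eqF// ltr_wpDr.
have dF (x : R) : 0 <= x <= b -> is_derive x 1 (fun x => - (A + x)^-1) ((A + x) ^+ 2)^-1.
  move=> /Ax xn0; apply: is_derive_eq.
  by rewrite /GRing.scale/= add0r mulr1 opprK.
rewrite (integral_is_derive b0 dF) ?addr0 ?opprK 1?addrC// => x /Ax xn0.
apply: continuousV; first by rewrite expf_neq0.
apply: (@continuous_comp _ _ _ (fun x => A + x) (fun y => y ^+ 2)).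
  by apply: continuousD => //; exact: cst_continuous.
exact: exprn_continuous.
Qed.

Lemma is_derive_lnD (A x : R) : 0 < A + x ->
  is_derive x 1 (fun x => ln (A + x)) (A + x)^-1.
Proof.
move=> Ax0; apply: is_derive_eq.
  by apply: (@is_derive1_comp _ (@ln R) (fun x => A + x)); exact: is_derive1_ln.
by rewrite add0r !mulr1.
Qed.

Lemma integral_inv (A b : R) : 0 < A -> 0 < b ->
  (\int[mu]_(x in `[0%R, b]) ((A + x)^-1)%:E = (ln (A + b) - ln A)%:E)%E.
Proof.
move=> A0 b0.
have Ax (x : R) : 0 <= x <= b -> 0 < A + x by move=> /andP[x0 _]; rewrite ltr_wpDr.
rewrite (integral_is_derive b0 (fun x xb => is_derive_lnD (Ax x xb))) ?addr0//.
move=> x /Ax xn0; apply: continuousV; first by rewrite gt_eqF.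
by apply: continuousD => //; exact: cst_continuous.
Qed.

(** Negation exchanges the two halves of the interval. Asking only for an inequality lets the
    overlap at 0 be added freely. *)
Lemma ge0_integral_normr (b : R) (f : R -> R) :
  measurable_fun setT f -> (forall x : R, 0 <= x <= b -> 0 <= f x) ->
  (\int[mu]_(x in `[(- b)%R, b]) (f `|x|)%:E <=
   2%:E * \int[mu]_(x in `[0%R, b]) (f x)%:E)%E.
Proof.
move=> mf f0.
have mfn : measurable_fun setT (fun x : R => (f `|x|)%:E).
  apply/measurable_EFinP; apply: measurableT_comp => //; exact: normr_measurable.
have fn0 (x : R) : - b <= x <= b -> (0 <= (f `|x|)%:E)%E.
  by move=> xb; rewrite lee_fin f0// normr_ge0 ler_norml.
have E : (\int[mu]_(x in `[0%R, b]) (f x)%:E =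
          \int[mu]_(x in `[0%R, b]) (f `|x|)%:E)%E.
  by apply: eq_integral => x; rewrite inE/= in_itv/= => /andP[x0 _]; rewrite ger0_norm.
have m1 : measurable (`[- b, 0[%classic : set (measurableTypeR R)) by [].
have m2 : measurable (`[0, b]%classic : set (measurableTypeR R)) by [].
have m3 : measurable (`[- b, 0]%classic : set (measurableTypeR R)) by [].
have mD := measurableU _ _ m1 m2.
have D0 x : (`[- b, 0[ `|` `[0, b])%classic x -> - b <= x <= b.
  by move=> [] /=; rewrite in_itv/= => /andP[h1 h2]; apply/andP; split; lra.
apply: (@le_trans _ _ (\int[mu]_(x in `[(- b)%R, 0%R[ `|` `[0%R, b]) (f `|x|)%:E)%E).
  apply: ge0_subset_integral => //.
  - exact: measurable_funTS.
  - by move=> x /D0; exact: fn0.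
  - move=> x /=; rewrite !in_itv/= => /andP[h1 h2].
    by case: (ltP x 0) => hx; [left|right]; rewrite ?h1 ?h2 ?hx.
rewrite ge0_integral_setU//; first last.
- rewrite disj_set2E; apply/eqP; apply/seteqP; split => // x [] /=.
  by rewrite !in_itv/= => /andP[_ h1] /andP[h2 _]; rewrite ltNge h2 in h1.
- by move=> x /D0; exact: fn0.
- exact: measurable_funTS.
rewrite E (_ : 2%:E = 1 + 1)%E//.
have I0 : (0 <= \int[mu]_(x in `[0%R, b]) (f `|x|)%:E)%E.
  by apply: integral_ge0 => x /=; rewrite in_itv/= => /andP[h1 h2];
    apply: fn0; apply/andP; split; lra.
rewrite ge0_muleDl// mul1e leeD2r//.
apply: (@le_trans _ _ (\int[mu]_(x in `[(- b)%R, 0%R]) (f `|x|)%:E)%E).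
  apply: ge0_subset_integral => //.
  - exact: measurable_funTS.
  - by move=> x /=; rewrite in_itv/= => /andP[h1 h2];
    apply: fn0; apply/andP; split; lra.
  - by move=> x /=; rewrite !in_itv/= => /andP[-> /ltW ->].
rewrite integral_mkcond [leRHS]integral_mkcond -ge0_integral_oppr; last 2 first.
- exact/(measurable_restrictT _ m3)/measurable_funTS.
- move=> x; apply: erestrict_ge0 => y /=; rewrite in_itv/= => /andP[h1 h2];
    apply: fn0; apply/andP; split; lra.
rewrite le_eqVlt; apply/orP; left; apply/eqP/eq_integral => x _; rewrite !patchE normrN.
suff -> : (- x \in `[- b, 0]%classic) = (x \in `[0, b]%classic) by [].
by apply/idP/idP; rewrite !inE/= !in_itv/= lerN2 oppr_le0 andbC.
Qed.

Lemma integral_scale_le (D : set R) (f : R -> R) (k U : R) :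
  measurable D -> measurable_fun setT f -> (forall x, D x -> 0 <= f x) ->
  0 <= k -> (\int[mu]_(x in D) (f x)%:E <= U%:E)%E ->
  (\int[mu]_(x in D) (k * f x)%:E <= (k * U)%:E)%E.
Proof.
move=> mD mf f0 k0 fU; under eq_integral do rewrite EFinM.
rewrite ge0_integralZl//; last exact/measurable_funTS/measurable_EFinP.
by rewrite EFinM lee_wpmul2l.
Qed.

Let even_le (f : R -> R) (U : R) :
  measurable_fun setT f -> (forall x : R, 0 <= x <= 1 -> 0 <= f x) ->
  (\int[mu]_(x in `[0%R, 1%R]) (f x)%:E <= U%:E)%E ->
  (\int[mu]_(x in `[(-1)%R, 1%R]) (f `|x|)%:E <= (2 * U)%:E)%E.
Proof.
move=> mf f0 fU; apply: le_trans (ge0_integral_normr mf f0) _.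
by rewrite EFinM lee_wpmul2l.
Qed.

Lemma integral_inv_sqr_normr (A : R) : 0 < A ->
  (\int[mu]_(x in `[(-1)%R, 1%R]) (((A + `|x|) ^+ 2)^-1)%:E <= (2 / A)%:E)%E.
Proof.
move=> A0; apply: (even_le (f := fun x => ((A + x) ^+ 2)^-1)).
- apply: measurable_funVr; apply: measurable_funX; exact: measurable_funD.
- by move=> x x0; rewrite invr_ge0 sqr_ge0.
- rewrite integral_inv_sqr// lee_fin gerBl invr_ge0; lra.
Qed.

Lemma integral_inv_normr (A : R) : 0 < A ->
  (\int[mu]_(x in `[(-1)%R, 1%R]) ((A + `|x|)^-1)%:E <=
   (2 * (ln (A + 1) - ln A))%:E)%E.
Proof.
move=> A0; apply: (even_le (f := fun x => (A + x)^-1)).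
- apply: measurable_funVr; exact: measurable_funD.
- by move=> x /andP[x0 _]; rewrite invr_ge0; lra.
- by rewrite integral_inv.
Qed.

(** The logarithmic singularity is integrable, so the bound is uniform in [A]. The constant [ln 3]
    keeps the integrand nonnegative, as $A+|x|\le2$. By the primitive $y\ln y-y$ of $\ln y$, the
    integral over $[0,1]$ is $\ln3+1-(A+1)\ln(A+1)+A\ln A\le2+1$. *)
Lemma integral_ln_normr (A : R) : 0 < A <= 1 ->
  (\int[mu]_(x in `[(-1)%R, 1%R]) (ln 3 - ln (A + `|x|))%:E <= (2 * 3)%:E)%E.
Proof.
move=> /andP[A0 A1].
have Ax (x : R) : 0 <= x <= 1 -> 0 < A + x by move=> /andP[x0 _]; rewrite ltr_wpDr.
apply: (even_le (f := fun x => ln 3 - ln (A + x))).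
- apply: measurable_funB => //; apply: measurableT_comp; first exact: measurable_ln.
  exact: measurable_funD.
- by move=> x x01; rewrite subr_ge0 ler_ln ?posrE ?Ax//; lra.
have dF (x : R) : 0 <= x <= 1 -> is_derive x 1
    (fun x => x * ln 3 - ((A + x) * ln (A + x) - (A + x))) (ln 3 - ln (A + x)).
  move=> /Ax xn0; have := is_derive_lnD xn0 => dl.
  apply: is_derive_eq.
  rewrite /GRing.scale/= !mulr1 !add0r mulfV ?gt_eqF//; lra.
rewrite (integral_is_derive ltr01 dF).
- rewrite lee_fin addr0 mul0r mul1r.
  have h1 : ln 3 <= 2 :> R.
    have -> : 3 = 1 + 2 :> R by ring.
    by apply: le_ln1Dx; lra.
  have h2 : 0 <= (A + 1) * ln (A + 1) by rewrite mulr_ge0 ?ln_ge0//; lra.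
  have h3 : A * ln A <= 0 by rewrite mulr_ge0_le0 ?ln_le0 ?(ltW A0).
  lra.
- move=> x /Ax xn0; apply: continuousB; first exact: cst_continuous.
  apply: (@continuous_comp _ _ _ (fun x => A + x) (@ln R)).
    by apply: continuousD => //; exact: cst_continuous.
  exact: continuous_ln.
Qed.

End one_dimensional.

(** * Iterated integrals over cubes *)

Section iterated_bounds.
Context {R : realType}.
Let mu := @lebesgue_measure R.
Let lam n : {measure set (n.-tuple R) -> \bar R} := lebesgue_tuple n.

Lemma boxS n (a b : R) : @box R n.+1 a b = consset `[a, b]%classic (@box R n a b).
Proof.
apply/funext => t; case/tupleP: t => x t; rewrite -/(tcons (x, t)) consset_tcons.
exact: (congr1 (fun S : set (measurableTypeR R * n.-tuple R) => S (x, t)) (box_tcons n a b)).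
Qed.

Lemma box0 (a b : R) : @box R 0 a b = setT.
Proof. by apply/seteqP; split => // t _ []. Qed.

Lemma measurable_integral_consset n (B : set (n.-tuple R)) (f : n.+1.-tuple R -> R) :
  measurable B -> measurable_fun setT f -> (forall t, 0 <= f t) ->
  measurable_fun setT (fun x => \int[lam n]_(t in B) (f (tcons (x, t)))%:E)%E.
Proof.
move=> mB mf f0; pose g := ((EFin \o f) \_ (consset setT B))%E.
have mC : measurable (consset setT B) by exact: measurable_consset.
rewrite (_ : (fun x => _) = (fun x => \int[lam n]_t g (tcons (x, t)))%E).
  apply: measurable_integral_tcons.
    exact/(measurable_restrictT _ mC)/measurable_funTS/measurable_EFinP.
  by move=> t; apply: erestrict_ge0 => s _; rewrite lee_fin.
apply/funext => x; rewrite integral_mkcond; apply: eq_integral => t _.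
rewrite /g !patchE; suff -> : (tcons (x, t) \in consset setT B) = (t \in B) by [].
by apply/idP/idP; rewrite !inE consset_tcons => //; case.
Qed.

Lemma integral_consset_le n (A : set R) (B : set (n.-tuple R))
    (f : n.+1.-tuple R -> R) (h : R -> R) :
  measurable A -> measurable B -> measurable_fun setT f -> (forall t, 0 <= f t) ->
  measurable_fun setT h ->
  (forall x, A x -> (\int[lam n]_(t in B) (f (tcons (x, t)))%:E <= (h x)%:E)%E) ->
  (\int[lam n.+1]_(t in consset A B) (f t)%:E <= \int[mu]_(x in A) (h x)%:E)%E.
Proof.
move=> mA mB mf f0 mh fh; rewrite ge0_integral_consset//.
- apply: ge0_le_integral => //.
  + by move=> x Ax; apply: integral_ge0 => t _; rewrite lee_fin.
  + by apply: measurable_funTS; exact: measurable_integral_consset.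
  + exact/measurable_funTS/measurable_EFinP.
- exact/measurable_EFinP.
Qed.

Lemma integral_consset_ge n (A : set R) (B : set (n.-tuple R))
    (f : n.+1.-tuple R -> R) (h : R -> R) :
  measurable A -> measurable B -> measurable_fun setT f -> (forall t, 0 <= f t) ->
  measurable_fun setT h -> (forall x, A x -> 0 <= h x) ->
  (forall x, A x -> ((h x)%:E <= \int[lam n]_(t in B) (f (tcons (x, t)))%:E)%E) ->
  (\int[mu]_(x in A) (h x)%:E <= \int[lam n.+1]_(t in consset A B) (f t)%:E)%E.
Proof.
move=> mA mB mf f0 mh h0 hf; rewrite ge0_integral_consset//.
- apply: ge0_le_integral => //.
  + exact/measurable_funTS/measurable_EFinP.
  + by apply: measurable_funTS; exact: measurable_integral_consset.
- exact/measurable_EFinP.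
Qed.

Lemma integral_box_le_tcons n (a b : R) (f : n.+1.-tuple R -> R)
    (g : n.-tuple R -> R) (k U : R) :
  a < b -> 0 <= k ->
  measurable_fun setT f -> (forall t, 0 <= f t) ->
  measurable_fun setT g -> (forall t, 0 <= g t) ->
  (forall x t, a <= x <= b -> f (tcons (x, t)) <= k * g t) ->
  (\int[lam n]_(t in @box R n a b) (g t)%:E <= U%:E)%E ->
  (\int[lam n.+1]_(t in @box R n.+1 a b) (f t)%:E <= ((b - a) * (k * U))%:E)%E.
Proof.
move=> ab k0 mf f0 mg g0 fg gU; rewrite boxS.
apply: (@le_trans _ _ (\int[mu]_(x in `[a, b]) (k * U)%:E)%E); last first.
  by rewrite integral_cst//= lebesgue_measure_itv/= lte_fin ab -EFinB -EFinM mulrC.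
apply: integral_consset_le => //; first exact: measurable_box.
move=> x; rewrite /= in_itv/= => xab.
apply: (@le_trans _ _ (\int[lam n]_(t in @box R n a b) (k * g t)%:E)%E).
  apply: ge0_le_integral => //.
  - exact: measurable_box.
  - by move=> t _; rewrite lee_fin.
  - apply/measurable_funTS/measurable_EFinP; exact: measurable_tcons2.
  - by apply/measurable_funTS/measurable_EFinP; exact: measurable_funM.
  - by move=> t _; rewrite lee_fin fg.
under eq_integral do rewrite EFinM.
rewrite ge0_integralZl//; last 3 first.
- exact: measurable_box.
- exact/measurable_funTS/measurable_EFinP.
- by move=> t _; rewrite lee_fin.
by rewrite EFinM lee_wpmul2l.
Qed.

(** The head may be confined to a subinterval: this keeps it away from 0, where a share can
    vanish. *)
Lemma integral_box_ge_tcons n (a b a' b' : R) (f : n.+1.-tuple R -> R)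
    (g : n.-tuple R -> R) (k U : R) :
  a' < b' -> a <= a' -> b' <= b -> 0 <= k -> 0 <= U ->
  measurable_fun setT f -> (forall t, 0 <= f t) ->
  measurable_fun setT g -> (forall t, 0 <= g t) ->
  (forall x t, a' <= x <= b' -> @box R n a b t -> k * g t <= f (tcons (x, t))) ->
  (U%:E <= \int[lam n]_(t in @box R n a b) (g t)%:E)%E ->
  (((b' - a') * (k * U))%:E <= \int[lam n.+1]_(t in @box R n.+1 a b) (f t)%:E)%E.
Proof.
move=> ab aa bb k0 U0 mf f0 mg g0 fg gU; rewrite boxS.
apply: (@le_trans _ _ (\int[mu]_(x in `[a', b']) (k * U)%:E)%E).
  by rewrite integral_cst//= lebesgue_measure_itv/= lte_fin ab -EFinB -EFinM mulrC.
have mB := @measurable_box R n a b.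
apply: (@le_trans _ _ (\int[lam n.+1]_(t in consset `[a', b']%classic (@box R n a b)) (f t)%:E)%E).
  apply: integral_consset_ge => //; first by move=> x _; rewrite mulr_ge0.
  move=> x; rewrite /= in_itv/= => xab.
  apply: (@le_trans _ _ (\int[lam n]_(t in @box R n a b) (k * g t)%:E)%E); last first.
    apply: ge0_le_integral => //.
    - by move=> t _; rewrite lee_fin mulr_ge0.
    - by apply/measurable_funTS/measurable_EFinP; exact: measurable_funM.
    - apply/measurable_funTS/measurable_EFinP; exact: measurable_tcons2.
    - by move=> t Bt; rewrite lee_fin fg.
  under eq_integral do rewrite EFinM.
  rewrite ge0_integralZl//; last 2 first.
  - exact/measurable_funTS/measurable_EFinP.
  - by move=> t _; rewrite lee_fin.
  by rewrite EFinM lee_wpmul2l.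
apply: ge0_subset_integral => //.
- exact: measurable_consset.
- exact: measurable_consset.
- exact/measurable_funTS/measurable_EFinP.
- by move=> t _; rewrite lee_fin.
- move=> t [/= h1 h2]; split => //; move: h1; rewrite /= !in_itv/= => /andP[h3 h4].
  by rewrite (le_trans aa h3) (le_trans h4 bb).
Qed.

(* Comparing [s^2 + |t|^2] with [(s + |t|_1)^2] makes the successive
   one-dimensional integrals elementary. *)
Definition inv_sqr_l1 n (A : R) (t : n.-tuple R) : R :=
  ((A + \sum_i `|tnth t i|) ^+ 2)^-1.

Lemma measurable_inv_sqr_l1 n (A : R) : measurable_fun setT (@inv_sqr_l1 n A).
Proof.
apply: measurable_funVr; apply: measurable_funX; apply: measurable_funD => //.
apply: measurable_sum => i; apply: measurableT_comp; first exact: normr_measurable.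
exact: measurable_tnth.
Qed.

Lemma inv_sqr_l1_ge0 n (A : R) (t : n.-tuple R) : 0 <= inv_sqr_l1 A t.
Proof. by rewrite invr_ge0 sqr_ge0. Qed.

(** An extra coordinate only shifts the parameter, so a bound in dimension [n] valid for all
    parameters feeds directly into dimension [n.+1]. *)
Lemma inv_sqr_l1_tcons n (A x : R) (t : n.-tuple R) :
  inv_sqr_l1 A (tcons (x, t)) = inv_sqr_l1 (A + `|x|) t.
Proof.
rewrite /inv_sqr_l1 big_ord_recl tnth0 addrA; congr ((_ + _) ^+ 2)^-1.
by apply: eq_bigr => i _; rewrite tnthS.
Qed.

Lemma integral_inv_sqr_l1_0 (A a b : R) :
  (\int[lam 0]_(t in @box R 0 a b) (inv_sqr_l1 A t)%:E = ((A ^+ 2)^-1)%:E)%E.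
Proof.
rewrite box0 integral_tuple0.
  by rewrite /inv_sqr_l1 big_ord0 addr0.
by apply/measurable_EFinP; exact: measurable_inv_sqr_l1.
Qed.

Lemma integral_inv_sqr_l1_le n (A : R) (h : R -> R) :
  measurable_fun setT h ->
  (forall x, -1 <= x <= 1 ->
    (\int[lam n]_(t in @box R n (-1) 1) (inv_sqr_l1 (A + `|x|) t)%:E <= (h x)%:E)%E) ->
  (\int[lam n.+1]_(t in @box R n.+1 (-1) 1) (inv_sqr_l1 A t)%:E <=
   \int[mu]_(x in `[(-1)%R, 1%R]) (h x)%:E)%E.
Proof.
move=> mh H; rewrite boxS; apply: integral_consset_le => //.
- exact: measurable_box.
- exact: measurable_inv_sqr_l1.
- by move=> t; exact: inv_sqr_l1_ge0.
- move=> x; rewrite /= in_itv/= => /H.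
  under [X in _ -> (X <= _)%E]eq_integral do rewrite inv_sqr_l1_tcons.
  by [].
Qed.

Lemma integral_inv_sqr_l1_ge n (A b : R) (h : R -> R) :
  measurable_fun setT h -> (forall x, 0 <= x <= b -> 0 <= h x) ->
  (forall x, 0 <= x <= b ->
    ((h x)%:E <= \int[lam n]_(t in @box R n 0 b) (inv_sqr_l1 (A + x) t)%:E)%E) ->
  (\int[mu]_(x in `[0%R, b]) (h x)%:E <=
   \int[lam n.+1]_(t in @box R n.+1 0 b) (inv_sqr_l1 A t)%:E)%E.
Proof.
move=> mh h0 H; rewrite boxS; apply: integral_consset_ge => //.
- exact: measurable_box.
- exact: measurable_inv_sqr_l1.
- by move=> t; exact: inv_sqr_l1_ge0.
- move=> x; rewrite /= in_itv/= => xb; have := H x xb.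
  under [X in _ -> (_ <= X)%E]eq_integral do rewrite inv_sqr_l1_tcons.
  by rewrite ger0_norm//; case/andP: xb.
Qed.

Lemma integral_inv_sqr_l1_1_le (A : R) : 0 < A ->
  (\int[lam 1]_(t in @box R 1 (-1) 1) (inv_sqr_l1 A t)%:E <= (2 * A^-1)%:E)%E.
Proof.
move=> A0; apply: le_trans (integral_inv_sqr_normr A0).
apply: integral_inv_sqr_l1_le; last by move=> x _; rewrite integral_inv_sqr_l1_0.
by apply: measurable_funVr; apply: measurable_funX; exact: measurable_funD.
Qed.

Lemma integral_inv_sqr_l1_2_le (A : R) : 0 < A ->
  (\int[lam 2]_(t in @box R 2 (-1) 1) (inv_sqr_l1 A t)%:E <=
   (4 * (ln (A + 1) - ln A))%:E)%E.
Proof.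
move=> A0; have mi : measurable_fun setT (fun x : R => (A + `|x|)^-1).
  by apply: measurable_funVr; exact: measurable_funD.
apply: le_trans (integral_inv_sqr_l1_le (h := fun x => 2 * (A + `|x|)^-1) _ _) _.
- exact: measurable_funM.
- by move=> x _; apply: integral_inv_sqr_l1_1_le; rewrite ltr_wpDr.
- have -> : 4 * (ln (A + 1) - ln A) = 2 * (2 * (ln (A + 1) - ln A)) by ring.
  apply: integral_scale_le => //.
  + by move=> x _; rewrite invr_ge0 addr_ge0// ltW.
  + exact: integral_inv_normr.
Qed.

Lemma integral_inv_sqr_l1_3_le (A : R) : 0 < A <= 1 ->
  (\int[lam 3]_(t in @box R 3 (-1) 1) (inv_sqr_l1 A t)%:E <= 24%:E)%E.
Proof.
move=> A01; have /andP[A0 A1] := A01.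
have mi : measurable_fun setT (fun x : R => ln 3 - ln (A + `|x|)).
  apply: measurable_funB => //; apply: measurableT_comp; first exact: measurable_ln.
  exact: measurable_funD.
have x1 (x : R) : -1 <= x <= 1 -> `|x| <= 1 by rewrite ler_norml.
apply: le_trans (integral_inv_sqr_l1_le (h := fun x => 4 * (ln 3 - ln (A + `|x|))) _ _) _.
- exact: measurable_funM.
- move=> x /x1 hx; have Ax : 0 < A + `|x| by rewrite ltr_wpDr.
  apply: le_trans (integral_inv_sqr_l1_2_le Ax) _.
  (* Here $A+|x|+1\le3$, the origin of [ln 3]. *)
  by rewrite lee_fin ler_wpM2l// lerB// ler_ln ?posrE; lra.
- have -> : 24 = 4 * (2 * 3) :> R by ring.
  apply: integral_scale_le => //; last exact: integral_ln_normr.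
  move=> x; rewrite /= in_itv/= => /x1 hx; have Ax : 0 < A + `|x| by rewrite ltr_wpDr.
  by rewrite subr_ge0 ler_ln ?posrE; lra.
Qed.

Lemma integral_inv_sqr_l1_1_ge (A b : R) : 0 < A -> 0 < b ->
  ((A^-1 - (A + b)^-1)%:E <= \int[lam 1]_(t in @box R 1 0 b) (inv_sqr_l1 A t)%:E)%E.
Proof.
move=> A0 b0; rewrite -integral_inv_sqr//.
apply: integral_inv_sqr_l1_ge.
- by apply: measurable_funVr; apply: measurable_funX; exact: measurable_funD.
- by move=> x _; rewrite invr_ge0 sqr_ge0.
- by move=> x _; rewrite integral_inv_sqr_l1_0.
Qed.

(** The one-dimensional lower bound is integrated without further loss, with primitive
    $\ln(A+x)-\ln(A+b+x)$. For fixed [b] the result grows like $-\ln A$ as $A\to0$. *)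
Lemma integral_inv_sqr_l1_2_ge (A b : R) : 0 < A -> 0 < b ->
  ((2 * ln (A + b) - ln A - ln (A + b + b))%:E <=
   \int[lam 2]_(t in @box R 2 0 b) (inv_sqr_l1 A t)%:E)%E.
Proof.
move=> A0 b0.
apply: le_trans (integral_inv_sqr_l1_ge (h := fun x => (A + x)^-1 - (A + b + x)^-1) _ _ _).
- have cf (B x : R) : 0 < B -> 0 <= x <= b -> {for x, continuous (fun x => (B + x)^-1)}.
    move=> B0 /andP[x0 _]; apply: continuousV; first by rewrite gt_eqF// ltr_wpDr.
    by apply: continuousD => //; exact: cst_continuous.
  have dF (x : R) : 0 <= x <= b -> is_derive x 1
      (fun x => ln (A + x) - ln (A + b + x)) ((A + x)^-1 - (A + b + x)^-1).
    move=> /andP[x0 _].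
    have d1 : 0 < A + x by lra. have d2 : 0 < A + b + x by lra.
    have := is_derive_lnD d1; have := is_derive_lnD d2 => h1 h2.
    exact: is_deriveB.
  rewrite (integral_is_derive b0 dF).
    by rewrite lee_fin !addr0; lra.
  by move=> x xb; apply: continuousB; apply: cf => //; lra.
- by apply: measurable_funB; apply: measurable_funVr; exact: measurable_funD.
- move=> x /andP[x0 _]; rewrite subr_ge0 lef_pV2 ?posrE; lra.
- move=> x /andP[x0 xb]; rewrite (_ : A + b + x = A + x + b); last by ring.
  by apply: integral_inv_sqr_l1_1_ge => //; lra.
Qed.

End iterated_bounds.

(** * Integrals of the shares *)

Section share_bounds.
Context {R : realType}.
Let lam n : {measure set (n.-tuple R) -> \bar R} := lebesgue_tuple n.

Lemma sum_sqr_tcons n (a : 'I_n.+1 -> R) x (t : n.-tuple R) :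
  \sum_i (a i * tnth (tcons (x, t)) i) ^+ 2 =
  (a ord0 * x) ^+ 2 + \sum_i (a (lift ord0 i) * tnth t i) ^+ 2.
Proof.
rewrite big_ord_recl tnth0; congr (_ + _).
by apply: eq_bigr => i _; rewrite tnthS.
Qed.

Lemma sqr_l1_le n (s : R) (t : n.-tuple R) : 0 <= s ->
  (s + \sum_i `|tnth t i|) ^+ 2 <= n.+1%:R * (s ^+ 2 + \sum_i tnth t i ^+ 2).
Proof.
(* [s] is treated as one more coordinate, hence the factor [n.+1]. *)
move=> s0; have := sqr_sum_le (fun i => `|tnth (tcons (s, t)) i|).
rewrite !big_ord_recl tnth0 (ger0_norm s0).
rewrite (eq_bigr (fun i => `|tnth t i|)) => [|i _]; last by rewrite tnthS.
rewrite [in leRHS](eq_bigr (fun i => tnth t i ^+ 2)) // => i _.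
by rewrite tnthS real_normK// num_real.
Qed.

Lemma sqr_l1_ge n (s : R) (t : n.-tuple R) : 0 <= s ->
  s ^+ 2 + \sum_i tnth t i ^+ 2 <= (s + \sum_i `|tnth t i|) ^+ 2.
Proof.
move=> s0; have := @sum_sqr_le_sqr_sum R n (fun i => `|tnth t i|) (fun i => normr_ge0 _).
rewrite (eq_bigr (fun i => tnth t i ^+ 2)) => [h|i _]; last by rewrite real_normK// num_real.
have p0 : 0 <= \sum_i `|tnth t i| by apply: sumr_ge0.
have := mulr_ge0 s0 p0; nra.
Qed.

(** The quotient grows with $x^2$ and decreases with [r], so $x^2$ may be replaced by 1 and [r] by 0
    before [sqr_l1_le] applies. The term [r] makes room for a second coordinate of small weight. *)
Lemma ratio_le n (s x r : R) (t : n.-tuple R) : 0 < s -> -1 <= x <= 1 -> 0 <= r ->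
  (s * x) ^+ 2 / ((s * x) ^+ 2 + (r + \sum_i tnth t i ^+ 2)) <=
  n.+1%:R * s ^+ 2 * inv_sqr_l1 s t.
Proof.
move=> s0 /andP[x1 x2] r0; rewrite /inv_sqr_l1.
have q0 : 0 <= \sum_i tnth t i ^+ 2 by apply: sumr_ge0 => i _; exact: sqr_ge0.
have p0 : 0 <= \sum_i `|tnth t i| by apply: sumr_ge0.
have H := sqr_l1_le t (ltW s0).
move: (\sum_i `|_|) (\sum_i _ ^+ 2) p0 q0 H => p q p0 q0 H.
have D0 : 0 <= (s * x) ^+ 2 + (r + q) by rewrite addr_ge0 ?sqr_ge0 ?addr_ge0.
have [->|Dn0] := eqVneq ((s * x) ^+ 2 + (r + q)) 0.
  by rewrite invr0 mulr0 mulr_ge0 ?invr_ge0 ?sqr_ge0// mulr_ge0 ?sqr_ge0.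
rewrite ler_pdivrMr ?lt_def ?Dn0//= mulrAC ler_pdivlMr; last by rewrite exprn_gt0// ltr_pwDl.
apply: (@le_trans _ _ ((s * x) ^+ 2 * (n.+1%:R * (s ^+ 2 + q)))).
  by rewrite ler_wpM2l ?sqr_ge0.
have -> : (s * x) ^+ 2 * (n.+1%:R * (s ^+ 2 + q)) =
  n.+1%:R * s ^+ 2 * ((s * x) ^+ 2 + x ^+ 2 * q) by ring.
rewrite ler_wpM2l//; first by rewrite mulr_ge0// sqr_ge0.
have : x ^+ 2 * q <= q by rewrite ler_piMl//; nra.
lra.
Qed.

Lemma ratio_ge n (s y D : R) (t : n.-tuple R) : 0 < s -> 0 < D ->
  D <= s ^+ 2 + \sum_i tnth t i ^+ 2 ->
  s ^+ 2 * (y ^+ 2 * inv_sqr_l1 s t) <= (s * y) ^+ 2 / D.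
Proof.
move=> s0 D0 Ds; rewrite mulrA -exprMn ler_wpM2l ?sqr_ge0// lef_pV2 ?posrE//.
- exact: le_trans Ds (sqr_l1_ge _ (ltW s0)).
- by rewrite exprn_gt0// ltr_pwDl// sumr_ge0.
Qed.

(** On $[1/4,1/2]^n$, of volume $4^{-n}$, the numerator is at least $a_i^2/16$ and the denominator
    at most $n/4$. This is sharp up to constants for weights equal to 1, and in dimension 4 for the
    small weight too. *)
Lemma integral_share_ge n (a : 'I_n -> R) i : (forall j, 0 < a j <= 1) ->
  ((4^-1 ^+ n * (a i ^+ 2 / (4 * n%:R)))%:E <=
   \int[lam n]_(t in @box R n 0 2^-1) (share a i t)%:E)%E.
Proof.
move=> a1; have n0 : (0 < n)%N by apply: leq_ltn_trans (ltn_ord i).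
have mB := @measurable_box R n 4^-1 2^-1.
apply: (@le_trans _ _ (\int[lam n]_(t in @box R n 4^-1 2^-1) (a i ^+ 2 / (4 * n%:R))%:E)%E).
  rewrite integral_cst//= lebesgue_box; last by lra.
  by rewrite -EFinM mulrC (_ : 2^-1 - 4^-1 = 4^-1 :> R)//; lra.
have ms : measurable_fun setT (fun t : n.-tuple R => (share a i t)%:E).
  by apply/measurable_EFinP; exact: measurable_share.
apply: (@le_trans _ _ (\int[lam n]_(t in @box R n 4^-1 2^-1) (share a i t)%:E)%E); last first.
  apply: ge0_subset_integral => //; first exact: measurable_box.
  - exact: measurable_funTS.
  - by move=> t _; rewrite lee_fin share_ge0.
  - move=> t Bt j; have := Bt j; rewrite !in_itv/= => /andP[h ->]; rewrite andbT; lra.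
apply: ge0_le_integral => //.
- by move=> t _; rewrite lee_fin divr_ge0 ?sqr_ge0 ?mulr_ge0.
- exact: measurable_funTS.
move=> t Bt; rewrite lee_fin /share.
have tB j : 4^-1 <= tnth t j <= 2^-1 by have := Bt j; rewrite in_itv.
have Di : a i ^+ 2 / 16 <= (a i * tnth t i) ^+ 2.
  have /andP[h1 h2] := tB i; rewrite exprMn ler_wpM2l ?sqr_ge0//; nra.
have ai0 : 0 < a i ^+ 2 by rewrite exprn_gt0//; case/andP: (a1 i).
have D0 : 0 < \sum_j (a j * tnth t j) ^+ 2.
  apply: (@lt_le_trans _ _ ((a i * tnth t i) ^+ 2)); first by lra.
  by rewrite (bigD1 i)//= lerDl sumr_ge0// => j _; exact: sqr_ge0.
have Dn : \sum_j (a j * tnth t j) ^+ 2 <= n%:R / 4.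
  apply: (@le_trans _ _ (\sum_(j < n) 4^-1)).
    apply: ler_sum => j _; have /andP[h1 h2] := tB j; have /andP[h3 h4] := a1 j.
    have h5 : 0 <= a j * tnth t j <= 1 * 2^-1.
      by apply/andP; split; [apply: mulr_ge0; lra|apply: ler_pM; lra].
    by case/andP: h5 => h5 h6; nra.
  by rewrite sumr_const card_ord -[leLHS]mulr_natl.
rewrite ler_pdivlMr//.
have nR : 0 < n%:R :> R by rewrite ltr0n.
apply: (@le_trans _ _ (a i ^+ 2 / (4 * n%:R) * (n%:R / 4))).
  by rewrite ler_wpM2l// divr_ge0 ?sqr_ge0 ?mulr_ge0.
apply: le_trans Di; rewrite le_eqVlt; apply/orP; left; apply/eqP; field.
by rewrite gt_eqF.
Qed.

Section one_small_weight.
Context (n : nat) (a : 'I_n.+1 -> R) (s : R).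
Hypotheses (s0 : 0 < s) (a0 : a ord0 = s) (a1 : forall i, a (lift ord0 i) = 1).

Let sumE x (t : n.-tuple R) : \sum_i (a i * tnth (tcons (x, t)) i) ^+ 2 =
  (s * x) ^+ 2 + \sum_i tnth t i ^+ 2.
Proof.
by rewrite sum_sqr_tcons a0; congr (_ + _); apply: eq_bigr => i _; rewrite a1 mul1r.
Qed.

Lemma integral_share0_le (U : R) :
  (\int[lam n]_(t in @box R n (-1) 1) (inv_sqr_l1 s t)%:E <= U%:E)%E ->
  (\int[lam n.+1]_(t in @box R n.+1 (-1) 1) (share a ord0 t)%:E <=
   (2 * (n.+1%:R * s ^+ 2 * U))%:E)%E.
Proof.
move=> HU; have -> : 2 = 1 - - 1 :> R by ring.
apply: integral_box_le_tcons HU.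
- lra.
- by rewrite mulr_ge0// sqr_ge0.
- exact: measurable_share.
- by move=> t; exact: share_ge0.
- exact: measurable_inv_sqr_l1.
- by move=> t; exact: inv_sqr_l1_ge0.
- move=> x t x1; rewrite /share sumE tnth0 a0.
  by rewrite -[X in _ + X]add0r; exact: ratio_le.
Qed.

Lemma integral_share0_ge (U : R) : 0 <= U ->
  (U%:E <= \int[lam n]_(t in @box R n 0 2^-1) (inv_sqr_l1 s t)%:E)%E ->
  ((4^-1 * (s ^+ 2 / 16 * U))%:E <=
   \int[lam n.+1]_(t in @box R n.+1 0 2^-1) (share a ord0 t)%:E)%E.
Proof.
(* The head is confined to $[1/4,1/2]$, of length 1/4, where $x^2\ge1/16$. *)
move=> U0 HU; have -> : 4^-1 = 2^-1 - 4^-1 :> R by lra.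
apply: integral_box_ge_tcons HU => //.
- lra.
- by rewrite divr_ge0// sqr_ge0.
- exact: measurable_share.
- by move=> t; exact: share_ge0.
- exact: measurable_inv_sqr_l1.
- by move=> t; exact: inv_sqr_l1_ge0.
- move=> x t /andP[x1 x2] _; rewrite /share sumE tnth0 a0.
  have q0 : 0 <= \sum_i tnth t i ^+ 2 by apply: sumr_ge0 => i _; exact: sqr_ge0.
  have sx : 0 < (s * x) ^+ 2 by rewrite exprn_gt0// mulr_gt0//; lra.
  apply: le_trans (ratio_ge (t := t) x s0 _ _).
  + rewrite -mulrA ler_wpM2l ?sqr_ge0// ler_wpM2r ?inv_sqr_l1_ge0//; nra.
  + by rewrite ltr_pwDl.
  + by rewrite lerD2r exprMn ler_piMr ?sqr_ge0//; nra.
Qed.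

End one_small_weight.

Section two_small_weights.
Context (n : nat) (a : 'I_n.+2 -> R) (s : R).
Hypotheses (s0 : 0 < s) (a0 : a ord0 = s) (a1 : a (lift ord0 ord0) = s).
Hypothesis a2 : forall i, a (lift ord0 (lift ord0 i)) = 1.

Let sumE x y (t : n.-tuple R) :
  \sum_i (a i * tnth (tcons (x, tcons (y, t))) i) ^+ 2 =
  (s * x) ^+ 2 + ((s * y) ^+ 2 + \sum_i tnth t i ^+ 2).
Proof.
rewrite sum_sqr_tcons (sum_sqr_tcons (fun i => a (lift ord0 i))) a0 a1.
congr (_ + (_ + _)).
by apply: eq_bigr => i _; rewrite a2 mul1r.
Qed.

Let tl (t : n.+1.-tuple R) : n.-tuple R := [tuple of behead t].

Let tl_tcons y t : tl (tcons (y, t)) = t.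
Proof. exact: val_inj. Qed.

Let measurable_inv_tl : measurable_fun setT (fun t => inv_sqr_l1 s (tl t)).
Proof.
apply: (measurableT_comp (f := @inv_sqr_l1 R n s)); first exact: measurable_inv_sqr_l1.
exact: measurable_behead.
Qed.

(** The second small coordinate is discarded from the denominator, so integrating it costs only the
    length 2 of its interval. *)
Lemma integral_share01_le (U : R) :
  (\int[lam n]_(t in @box R n (-1) 1) (inv_sqr_l1 s t)%:E <= U%:E)%E ->
  (\int[lam n.+2]_(t in @box R n.+2 (-1) 1) (share a ord0 t)%:E <=
   (2 * (n.+1%:R * s ^+ 2 * (2 * (1 * U))))%:E)%E.
Proof.
move=> HU; have -> : 2 = 1 - - 1 :> R by ring.
apply: (integral_box_le_tcons (g := fun t => inv_sqr_l1 s (tl t))).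
- lra.
- by rewrite mulr_ge0// sqr_ge0.
- exact: measurable_share.
- by move=> t; exact: share_ge0.
- exact: measurable_inv_tl.
- by move=> t; exact: inv_sqr_l1_ge0.
- move=> x t x1; case/tupleP: t => y t; rewrite -/(tcons (y, t)) tl_tcons.
  by rewrite /share sumE tnth0 a0; apply: ratio_le => //; exact: sqr_ge0.
apply: integral_box_le_tcons HU => //.
- by move=> t; exact: inv_sqr_l1_ge0.
- exact: measurable_inv_sqr_l1.
- by move=> t; exact: inv_sqr_l1_ge0.
- by move=> y t _; rewrite tl_tcons mul1r.
Qed.

Let box_tconsE (b : R) y (t : n.-tuple R) :
  @box R n.+1 0 b (tcons (y, t)) -> 0 <= y <= b.
Proof. by move=> /(_ ord0); rewrite tnth0 in_itv. Qed.

Let den_le x y (t : n.-tuple R) : 4^-1 <= x <= 2^-1 -> 0 <= y <= 2^-1 ->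
  (s * x) ^+ 2 + ((s * y) ^+ 2 + \sum_i tnth t i ^+ 2) <= s ^+ 2 + \sum_i tnth t i ^+ 2.
Proof.
move=> /andP[x1 x2] /andP[y1 y2]; rewrite addrA lerD2r !exprMn -mulrDr.
by rewrite ler_piMr ?sqr_ge0//; nra.
Qed.

Let den_gt0 x y (t : n.-tuple R) : 4^-1 <= x <= 2^-1 ->
  0 < (s * x) ^+ 2 + ((s * y) ^+ 2 + \sum_i tnth t i ^+ 2).
Proof.
move=> /andP[x1 x2]; rewrite ltr_pwDl//.
  by rewrite exprn_gt0// mulr_gt0//; lra.
by rewrite addr_ge0 ?sqr_ge0// sumr_ge0// => i _; exact: sqr_ge0.
Qed.

Lemma integral_share01_ge (i : 'I_n.+2) (U : R) : 0 <= U ->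
  (i == ord0) || (i == lift ord0 ord0) ->
  (U%:E <= \int[lam n]_(t in @box R n 0 2^-1) (inv_sqr_l1 s t)%:E)%E ->
  ((4^-1 * (s ^+ 2 * (4^-1 * (16^-1 * U))))%:E <=
   \int[lam n.+2]_(t in @box R n.+2 0 2^-1) (share a i t)%:E)%E.
Proof.
move=> U0 i01 HU.
(* [g] is what is left after the head is bounded. The factor 1/16 comes from the head when [i] is
   the first coordinate, from the next one when [i] is the second; in that case the head only keeps
   the denominator positive. Both cases end with the same constant. *)
have [g [mg g0 gi gU]] : exists g : n.+1.-tuple R -> R,
  [/\ measurable_fun setT g, (forall t, 0 <= g t),
      (forall x t, 4^-1 <= x <= 2^-1 -> @box R n.+1 0 2^-1 t ->
         s ^+ 2 * g t <= share a i (tcons (x, t))) &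
      (forall y t, 4^-1 <= y <= 2^-1 -> 16^-1 * inv_sqr_l1 s t <= g (tcons (y, t)))].
  case/orP: i01 => /eqP ->.
  - exists (fun t => 16^-1 * inv_sqr_l1 s (tl t)); split.
    + exact: measurable_funM.
    + by move=> t; rewrite mulr_ge0 ?inv_sqr_l1_ge0.
    + move=> x t x1; case/tupleP: t => y t; rewrite -/(tcons (y, t)) tl_tcons.
      move=> /box_tconsE y1; rewrite /share sumE tnth0 a0.
      apply: le_trans (ratio_ge (t := t) x s0 (den_gt0 _ _ x1) (den_le _ x1 y1)).
      rewrite ler_wpM2l ?sqr_ge0// ler_wpM2r ?inv_sqr_l1_ge0//.
      by case/andP: x1 => x1 x2; nra.
    + by move=> y t _; rewrite tl_tcons.
  - exists (fun t => (thead t) ^+ 2 * inv_sqr_l1 s (tl t)); split.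
    + apply: measurable_funM => //; apply: measurable_funX; exact: measurable_tnth.
    + by move=> t; rewrite mulr_ge0 ?inv_sqr_l1_ge0 ?sqr_ge0.
    + move=> x t x1; case/tupleP: t => y t; rewrite -/(tcons (y, t)) tl_tcons.
      move=> /box_tconsE y1; rewrite /share sumE tnthS tnth0 a1 theadE.
      exact: (ratio_ge (t := t) y s0 (den_gt0 _ _ x1) (den_le _ x1 y1)).
    + move=> y t /andP[y1 y2]; rewrite tl_tcons theadE.
      by rewrite ler_wpM2r ?inv_sqr_l1_ge0//=; nra.
rewrite [X in ((X * (_ * _))%:E)%E](_ : 4^-1 = 2^-1 - 4^-1 :> R); last by lra.
apply: (integral_box_ge_tcons (g := g)) => //.
- lra.
- exact: sqr_ge0.
- by rewrite !mulr_ge0.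
- exact: measurable_share.
- by move=> t; exact: share_ge0.
rewrite [X in ((X * (_ * _))%:E)%E](_ : 4^-1 = 2^-1 - 4^-1 :> R); last by lra.
apply: (integral_box_ge_tcons (g := inv_sqr_l1 s)) => //.
- lra.
- exact: measurable_inv_sqr_l1.
- by move=> t; exact: inv_sqr_l1_ge0.
- by move=> y t y1 _; exact: gU.
Qed.

End two_small_weights.
End share_bounds.

(** One coordinate is enough above, where a single test vector is used; all are required below,
    where $\zeta$ is arbitrary. *)
Lemma asymp_rho (R : realType) n (c : R -> n.-tuple R) (g : R -> R) (k l u : R) i0 :
  (0 < n <= 4)%N -> 0 < k -> 0 < l -> 0 < u ->
  (forall x, k <= x -> forall i, 0 < tnth (c x) i) ->
  (forall x, k <= x -> (\int[lebesgue_tuple n]_(t in @box R n (-1) 1)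
     (share (weight (c x)) i0 t)%:E <= (u * g x)%:E)%E) ->
  (forall x, k <= x -> forall i, ((l * g x)%:E <=
     \int[lebesgue_tuple n]_(t in @box R n 0 2^-1) (share (weight (c x)) i t)%:E)%E) ->
  asymp (fun x => rho (diag (c x))) g.
Proof.
move=> n04 k0 l0 u0 c0 hu hl; have V0 := @ball_volume_gt0 R n.
exists k, (l / (2 * ball_volume n)), (u / (2 * ball_volume n)); split => //.
- by rewrite divr_gt0// mulr_gt0.
- by rewrite divr_gt0// mulr_gt0.
move=> x kx; rewrite ![_ / _ * _]mulrAC; apply/andP; split.
  by apply: rho_ge => // i; [exact: c0|exact: hl].
by apply: rho_le; [exact: c0|exact: hu].
Qed.

(** * The four rates *)

Section rates.
Context {R : realType}.

Lemma isqrt_itv (x : R) : 1 <= x -> 0 < (Num.sqrt x)^-1 <= 1.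
Proof.
move=> x1; have s1 : 1 <= Num.sqrt x by rewrite -sqrtr1 ler_wsqrtr.
by rewrite invr_gt0 invf_le1 ?(lt_le_trans ltr01 s1)// s1.
Qed.

Lemma sqr_isqrt (x : R) : 0 <= x -> (Num.sqrt x)^-1 ^+ 2 = x^-1.
Proof. by move=> x0; rewrite exprVn sqr_sqrtr. Qed.

Lemma powRN12 (x : R) : 0 <= x -> x `^ (- 2^-1) = (Num.sqrt x)^-1.
Proof. by move=> x0; rewrite powRN powR12_sqrt. Qed.

Lemma ln_isqrt (x : R) : 0 < x -> ln (Num.sqrt x)^-1 = - (ln x / 2).
Proof.
move=> x0; have s0 : 0 < Num.sqrt x by rewrite sqrtr_gt0.
have -> : ln x = ln (Num.sqrt x) *+ 2 by rewrite -lnXn// sqr_sqrtr// ltW.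
by rewrite lnV ?posrE//; lra.
Qed.

Lemma weight_one n (c : n.-tuple R) i : tnth c i = 1 -> weight c i = 1.
Proof. by rewrite /weight => ->; rewrite sqrtr1 invr1. Qed.

Lemma weight_itv n (c : n.-tuple R) : (forall i, 1 <= tnth c i) ->
  forall i, 0 < weight c i <= 1.
Proof. by move=> c1 i; exact: isqrt_itv. Qed.

(** $1/s-1/(s+1/2)=\frac{1/2}{s(s+1/2)}$, and $s+1/2\le3/2$. *)
Lemma integral_inv_sqr_l1_1_ge_inv (s : R) : 0 < s <= 1 ->
  ((3^-1 / s)%:E <=
   \int[lebesgue_tuple 1]_(t in @box R 1 0 2^-1) (inv_sqr_l1 s t)%:E)%E.
Proof.
move=> /andP[s0 s1].
apply: le_trans (integral_inv_sqr_l1_1_ge s0 _); last by lra.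
have -> : s^-1 - (s + 2^-1)^-1 = 2^-1 / (s * (s + 2^-1)).
  by field; rewrite !gt_eqF//; lra.
have sp : 0 < s * (s + 2^-1) by rewrite mulr_gt0//; lra.
rewrite lee_fin ler_pdivlMr// mulrA divfK ?gt_eqF//; lra.
Qed.

Lemma asymp_rho2 :
  asymp (fun x : R => rho (diag [tuple x; 1])) (fun x => x `^ (- 2^-1)).
Proof.
(* $192=4\cdot16\cdot3$ from the small weight; the weight 1 gives 1/128, which is larger. *)
have l0 : 0 < 192^-1 :> R by rewrite invr_gt0 ltr0n.
have u0 : 0 < 8 :> R by rewrite ltr0n.
apply: (asymp_rho (i0 := ord0) _ ltr01 l0 u0) => //.
- by move=> x x1 i; rewrite (tnth_nth 0); case: i => -[|[|]]//= _; lra.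
- move=> x x1; have x0 : 0 <= x by lra.
  have /andP[s0 s1] := isqrt_itv x1; rewrite powRN12//.
  set s := (Num.sqrt x)^-1 in s0 s1 *.
  have -> : 8 * s = 2 * (2%:R * s ^+ 2 * (2 * s^-1)) by field; rewrite gt_eqF.
  apply: integral_share0_le => //.
  + by move=> i; apply: weight_one; rewrite (tnth_nth 0); case: i => -[].
  + exact: integral_inv_sqr_l1_1_le.
- move=> x x1 i; have x0 : 0 <= x by lra.
  have /andP[s0 s1] := isqrt_itv x1; rewrite powRN12//.
  have c1 (j : 'I_2) : 1 <= tnth [tuple x; 1] j.
    by rewrite (tnth_nth 0); case: j => -[|[|]].
  case: (unliftP ord0 i) => [j ->|->].
    have w1 : weight [tuple x; 1] (lift ord0 j) = 1.
      by apply: weight_one; rewrite (tnth_nth 0); case: j => -[].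
    apply: le_trans (integral_share_ge _ (weight_itv c1)).
    by rewrite w1 lee_fin; lra.
  set s := (Num.sqrt x)^-1 in s0 s1 *.
  apply: le_trans (integral_share0_ge (s := s) _ _ _ (U := 3^-1 / s) _ _) => //.
  + by rewrite lee_fin le_eqVlt; apply/orP; left; apply/eqP; field; rewrite gt_eqF.
  + by move=> j; apply: weight_one; rewrite (tnth_nth 0); case: j => -[].
  + by rewrite divr_ge0// ltW.
  + by apply: integral_inv_sqr_l1_1_ge_inv; rewrite s0.
Qed.

Lemma asymp_rho3_two_large :
  asymp (fun x : R => rho (diag [tuple x; x; 1])) (fun x => x `^ (- 2^-1)).
Proof.
(* $768=4\cdot4\cdot16\cdot3$ from the small weights; the weight 1 gives the same $4^3\cdot12$. *)
have l0 : 0 < 768^-1 :> R by rewrite invr_gt0 ltr0n.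
have u0 : 0 < 16 :> R by rewrite ltr0n.
apply: (asymp_rho (i0 := ord0) _ ltr01 l0 u0) => //.
- by move=> x x1 i; rewrite (tnth_nth 0); case: i => -[|[|[|]]]//= _; lra.
- move=> x x1; have x0 : 0 <= x by lra.
  have /andP[s0 s1] := isqrt_itv x1; rewrite powRN12//.
  set s := (Num.sqrt x)^-1 in s0 s1 *.
  have -> : 16 * s = 2 * (2%:R * s ^+ 2 * (2 * (1 * (2 * s^-1)))).
    by field; rewrite gt_eqF.
  apply: integral_share01_le => //.
  + by move=> i; apply: weight_one; rewrite (tnth_nth 0); case: i => -[].
  + exact: integral_inv_sqr_l1_1_le.
- move=> x x1 i; have x0 : 0 <= x by lra.
  have /andP[s0 s1] := isqrt_itv x1; rewrite powRN12//.
  have c1 (j : 'I_3) : 1 <= tnth [tuple x; x; 1] j.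
    by rewrite (tnth_nth 0); case: j => -[|[|[|]]].
  have w1 (j : 'I_1) : weight [tuple x; x; 1] (lift ord0 (lift ord0 j)) = 1.
    by apply: weight_one; rewrite (tnth_nth 0); case: j => -[].
  have [i01|] := boolP ((i == ord0) || (i == lift ord0 ord0)); last first.
    case: (unliftP ord0 i) => [j ->|->]; last by rewrite eqxx.
    case: (unliftP ord0 j) => [l ->|->]; last by rewrite eqxx orbT.
    move=> _; apply: le_trans (integral_share_ge _ (weight_itv c1)).
    by rewrite w1 lee_fin; lra.
  set s := (Num.sqrt x)^-1 in s0 s1 *.
  apply: le_trans (integral_share01_ge (s := s) _ _ _ _ (U := 3^-1 / s) _ i01 _) => //.
  + by rewrite lee_fin le_eqVlt; apply/orP; left; apply/eqP; field; rewrite gt_eqF.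
  + by rewrite divr_ge0// ltW.
  + by apply: integral_inv_sqr_l1_1_ge_inv; rewrite s0.
Qed.

Lemma asymp_rho3_one_large :
  asymp (fun x : R => rho (diag [tuple x; 1; 1])) (fun x => x^-1 * ln x).
Proof.
have l2 : 0 <= ln 2 :> R by rewrite ln_ge0//; lra.
(* The threshold makes $3\ln2\le\frac14\ln x$, so that the lower bound $\frac12\ln x-3\ln2$ found in
   [J] is at least $\frac14\ln x$. Above, it turns $24\ln2+12\ln x$ into at most $14\ln x$. *)
have lx12 (x : R) : 2 ^+ 12 <= x -> 1 <= x /\ 12 * ln 2 <= ln x.
  move=> x1; have x2 : 1 <= x by apply: le_trans x1; rewrite exprn_ege1// ler1n.
  have -> : 12 * ln 2 = ln (2 ^+ 12) :> R by rewrite lnXn// mulr_natl.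
  by split => //; rewrite ler_ln ?posrE ?exprn_gt0//; exact: lt_le_trans ltr01 x2.
have ln1 (y : R) : 0 < y <= 2 -> ln y <= ln 2.
  by move=> /andP[y0 y1]; rewrite ler_ln ?posrE.
have w1 (x : R) (j : 'I_2) : weight [tuple x; 1; 1] (lift ord0 j) = 1.
  by apply: weight_one; rewrite (tnth_nth 0); case: j => -[|[|]].
(* $4^3\cdot12$, from the coordinates of weight 1; the small weight would allow 1/256. *)
have l0 : 0 < 768^-1 :> R by rewrite invr_gt0 ltr0n.
have k0 : 0 < 2 ^+ 12 :> R by rewrite exprn_gt0.
have u0 : 0 < 14 :> R by rewrite ltr0n.
apply: (asymp_rho (i0 := ord0) _ k0 l0 u0) => //.
- move=> x /lx12[x1 _] i; rewrite (tnth_nth 0); case: i => -[|[|[|]]]//= _; lra.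
- move=> x /lx12[xx lx]; have x0 : 0 < x by lra.
  have /andP[s0 s1] := isqrt_itv xx; rewrite -(sqr_isqrt (ltW x0)).
  have ls := ln_isqrt x0.
  set s := (Num.sqrt x)^-1 in s0 s1 ls *.
  apply: le_trans (integral_share0_le s0 _ _ (integral_inv_sqr_l1_2_le s0)) _ => //.
  rewrite lee_fin.
  have -> : 2 * (3%:R * s ^+ 2 * (4 * (ln (s + 1) - ln s))) =
    s ^+ 2 * (24 * (ln (s + 1) - ln s)) by ring.
  rewrite [leRHS]mulrCA ler_wpM2l ?sqr_ge0//.
  have h : ln (s + 1) <= ln 2 by apply: ln1; apply/andP; split; lra.
  rewrite ls; lra.
- move=> x /lx12[xx lx] i; have x0 : 0 < x by lra.
  have /andP[s0 s1] := isqrt_itv xx.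
  have ls := ln_isqrt x0.
  have c1 (j : 'I_3) : 1 <= tnth [tuple x; 1; 1] j.
    by rewrite (tnth_nth 0); case: j => -[|[|[|]]].
  case: (unliftP ord0 i) => [j ->|->].
    apply: le_trans (integral_share_ge _ (weight_itv c1)).
    rewrite w1 lee_fin.
    have : x^-1 * ln x <= 1.
      by rewrite mulrC ler_pdivrMr// mul1r ltW// ln_sublinear.
    lra.
  rewrite -(sqr_isqrt (ltW x0)).
  set s := (Num.sqrt x)^-1 in s0 s1 ls *.
  have J : ln x / 4 <= 2 * ln (s + 2^-1) - ln s - ln (s + 2^-1 + 2^-1).
    have h1 : ln (s + 2^-1 + 2^-1) <= ln 2 by apply: ln1; apply/andP; split; lra.
    have h2 : - ln 2 <= ln (s + 2^-1).
      by rewrite -lnV ?posrE// ler_ln ?posrE//; lra.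
    rewrite ls; lra.
  apply: le_trans (integral_share0_ge (s := s) _ _ _ (U := ln x / 4) _ _) => //.
  + have : 0 <= s ^+ 2 * ln x by rewrite mulr_ge0 ?sqr_ge0 ?ln_ge0.
    by rewrite lee_fin; lra.
  + by rewrite divr_ge0 ?ln_ge0.
  + apply: le_trans (integral_inv_sqr_l1_2_ge s0 _); last by lra.
    by rewrite lee_fin.
Qed.

(** Every squared weight is at least $x^{-1}$, already the expected rate, so the crude
    [integral_share_ge] settles the lower bound for all coordinates at once. *)
Lemma asymp_rho4 :
  asymp (fun x : R => rho (diag [tuple x; 1; 1; 1])) (fun x => x^-1).
Proof.
have w1 (x : R) (j : 'I_3) : weight [tuple x; 1; 1; 1] (lift ord0 j) = 1.
  by apply: weight_one; rewrite (tnth_nth 0); case: j => -[|[|[|]]].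
have l0 : 0 < 4^-1 ^+ 4 / 16 :> R by rewrite divr_gt0// exprn_gt0// invr_gt0.
have u0 : 0 < 192 :> R by rewrite ltr0n.
apply: (asymp_rho (i0 := ord0) _ ltr01 l0 u0) => //.
- by move=> x x1 i; rewrite (tnth_nth 0); case: i => -[|[|[|[|]]]]//= _; lra.
- move=> x x1; have x0 : 0 <= x by lra.
  have s01 := isqrt_itv x1; have /andP[s0 _] := s01; rewrite -(sqr_isqrt x0).
  set s := (Num.sqrt x)^-1 in s0 s01 *.
  have -> : 192 * s ^+ 2 = 2 * (4%:R * s ^+ 2 * 24) by ring.
  by apply: integral_share0_le => //; exact: integral_inv_sqr_l1_3_le.
- move=> x x1 i; have x0 : 0 <= x by lra.
  have c1 (j : 'I_4) : 1 <= tnth [tuple x; 1; 1; 1] j.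
    by rewrite (tnth_nth 0); case: j => -[|[|[|[|]]]].
  apply: le_trans (integral_share_ge _ (weight_itv c1)).
  rewrite lee_fin; have xi1 : x^-1 <= 1 by rewrite invf_le1//; lra.
  have : x^-1 <= weight [tuple x; 1; 1; 1] i ^+ 2.
    case: (unliftP ord0 i) => [j ->|->]; first by rewrite w1 expr1n.
    by rewrite /weight sqr_isqrt.
  move: (_ ^+ 2) => w xw; rewrite -mulrA ler_wpM2l ?exprn_ge0//.
  by rewrite mulrC -natrM ler_wpM2r.
Qed.

End rates.

Theorem mainTheorem6 (R : realType) :
  [/\ asymp (fun kappa : R => rho (diag [tuple kappa; 1]))
            (fun kappa : R => kappa `^ (- 2^-1)),
      asymp (fun kappa : R => rho (diag [tuple kappa; kappa; 1]))
            (fun kappa : R => kappa `^ (- 2^-1)),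
      asymp (fun kappa : R => rho (diag [tuple kappa; 1; 1]))
            (fun kappa : R => kappa^-1 * ln kappa)
    & asymp (fun kappa : R => rho (diag [tuple kappa; 1; 1; 1]))
            (fun kappa : R => kappa^-1)].
Proof.
split; [exact: asymp_rho2|exact: asymp_rho3_two_large
       |exact: asymp_rho3_one_large|exact: asymp_rho4].
Qed.
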